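(* Consider a discrete-time controlled Markov process satisfying conditions (A), (B) and (L$'$) of the context, and let $(v_k,\lambda_k,V_k)_{k\ge0}$ be any sequence generated by the policy iteration algorithm described in the context (with arbitrary initial $v_0\in\mathfrak U_{\mathsf{sm}}$ and arbitrary choices of minimizers). Then: (i) for all $k\in\mathbb N$, $\lambda_{k+1}\le\lambda_k$, and $\lim_{k\to\infty}\lambda_k=\lambda^*$; (ii) $V_k$ converges pointwise on $S$, as $k\to\infty$, to $\psi^*$, where $\psi^*$ is the unique positive function on $S$ with $\psi^*(i_0)=1$ and $e^{\lambda^*}\psi^*(i)=\min_{u\in\mathbb U(i)}\big[e^{c(i,u)}\sum_{j\in S}\psi^*(j)P(j|i,u)\big]$ for all $i\in S$.
   Context: Discrete-time controlled Markov process (DTCMP). The state space is $S=\{1,2,\dots\}$. The action space $\mathbb U$ is a Borel space; for each $i\in S$, $\mathbb U(i)\subset\mathbb U$ is a nonempty compact Borel set of admissible actions; $\mathscr K=\{(i,u):i\in S,\ u\in\mathbb U(i)\}$. $P(\cdot|i,u)$ is a stochastic kernel on $S$ depending measurably on $(i,u)\in\mathscr K$, $P(j|i,u)=P(\{j\}|i,u)$, and $c:\mathscr K\to[0,\infty)$ is the one-stage cost. A history up to time $t$ is $h_t=(x_0,u_0,\dots,x_{t-1},u_{t-1},x_t)$ with $(x_s,u_s)\in\mathscr K$, $x_t\in S$. An admissible control is a sequence $\zeta=(\zeta_t)_{t\ge0}$ of measurable maps from histories to $\mathbb U$ with $\zeta_t(h_t)\in\mathbb U(x_t)$; the set of these is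 $\mathfrak U$. For $i\in S$, $\zeta\in\mathfrak U$, $\mathbb P_i^\zeta$ (expectation $\mathbb E_i^\zeta$) is the unique probability measure on $(S\times\mathbb U)^\infty$ under which $X_0=i$ and, conditionally on the history up to time $t$ (with $\zeta_t$ also denoting the action used at time $t$), $X_{t+1}\in A$ with probability $P(A|X_t,\zeta_t)$. $\mathfrak U_{\mathsf{sm}}$ is the set of stationary Markov controls: $\zeta_t(h_t)=v(x_t)$ for a map $v:S\to\mathbb U$ with $v(i)\in\mathbb U(i)$; we identify the control with $v$. Cost: $\mathscr E_i(c,\zeta)=\limsup_{T\to\infty}\frac1T\log\mathbb E_i^\zeta\big[e^{\sum_{t=0}^{T-1}c(X_t,\zeta_t)}\big]$ and $\lambda^*=\inf_{i\in S}\inf_{\zeta\in\mathfrak U}\mathscr E_i(c,\zeta)$. A function $g:S\to\mathbb R$ is norm-like if $\{i:g(i)\le\kappa\}$ is finite (or empty) for every $\kappa\in\mathbb R$. (A) For each $i\in S$ and each bounded $f:S\to\mathbb R$, the maps $u\mapsto c(i,u)$ and $u\mapsto\sum_{j}f(j)P(j|i,u)$ are continuous on $\mathbb U(i)$. (B) There is a (fixed) state $i_0\in S$ such that $P(j|i_0,u)>0$ for all $j\in S\setminus\{i_0\}$ and $u\in\mathbb U(i_0)$. (L$'$) The process is irreducible under every $v\in\mathfrak U_{\mathsf{sm}}$, and there are a norm-like function $\mathcal V:S\to[1,\infty)$, a constant $\widehat C>0$ and a finite set $\mathcal K\subset S$ such that one of the following holds. (a) For some $\beta\in(0,1)$, $\sup_{u\in\mathbb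 U(i)}\sum_{j}\mathcal V(j)P(j|i,u)\le(1-\beta)\mathcal V(i)+\widehat C\,\mathbf 1_{\mathcal K}(i)$ for all $i\in S$, and $\|c\|_\infty:=\sup_{i}\sup_{u\in\mathbb U(i)}c(i,u)<\gamma$, where $\gamma=\log\frac1{1-\beta}$. (b) For some norm-like $\ell:S\to[0,\infty)$, $\sup_{u\in\mathbb U(i)}\sum_{j}\mathcal V(j)P(j|i,u)\le\widehat C\,\mathbf 1_{\mathcal K}(i)+(1-\beta_i)\mathcal V(i)$ for all $i\in S$, where $\beta_i=1-e^{-\ell(i)}$; $i\mapsto\ell(i)-\max_{u\in\mathbb U(i)}c(i,u)$ is norm-like; and $\max_{u\in\mathbb U(i)}c(i,u)\le\eta\,\ell(i)$ for all $i\in S$ and some $\eta\in(0,1)$. Also, there is a state $z_\circ\in S$ with $\inf_{u\in\mathbb U(i)}P(z_\circ|i,u)>0$ for all $i\in S$. For $v\in\mathfrak U_{\mathsf{sm}}$ let $\lambda_1^{\rm d}(v)=\inf\{\lambda\in\mathbb R:\exists\,\Psi:S\to(0,\infty)\text{ with }e^{c(i,v(i))}\sum_j\Psi(j)P(j|i,v(i))\le e^{\lambda}\Psi(i)\ \forall i\in S\}$. Under conditions (A), (B) and (L$'$), $\lambda_1^{\rm d}(v)=\mathscr E_i(c,v)$ for all $i\in S$. Policy iteration algorithm. (1) Set $k=0$ and select any $v_0\in\mathfrak U_{\mathsf{sm}}$. (2) Given $v_k$, let $\lambda_k=\lambda_1^{\rm d}(v_k)=\mathscr E_i(c,v_k)$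 and let $V_k:S\to(0,\infty)$ be the unique positive function with $V_k(i_0)=1$ and $e^{\lambda_k}V_k(i)=e^{c(i,v_k(i))}\sum_{j\in S}V_k(j)P(j|i,v_k(i))$ for all $i\in S$ (it exists and is unique under conditions (A), (B) and (L$'$)). (3) Choose any $v_{k+1}\in\mathfrak U_{\mathsf{sm}}$ with $v_{k+1}(i)\in\operatorname{Arg\,min}_{u\in\mathbb U(i)}\big[e^{c(i,u)}\sum_{j\in S}V_k(j)P(j|i,u)\big]$ for all $i\in S$; increase $k$ by one and return to (2). *)

(* Defs.v *)
From HB Require Import structures.
From mathcomp Require Import all_boot all_order all_algebra.
From mathcomp Require Import all_classical all_reals all_analysis.
From mathcomp Require Import measurable_realfun.
Set Implicit Arguments.
Unset Strict Implicit.
Unset Printing Implicit Defensive.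
Import Order.TTheory GRing.Theory Num.Theory.
Import numFieldNormedType.Exports.
Local Open Scope classical_set_scope.
Local Open Scope ring_scope.

#[short(type="completeMetricType")]
HB.structure Definition CompleteMetric (R : numDomainType) :=
  {T of Complete T & Metric R T}.

Definition separable_space (E : topologicalType) : Prop :=
  exists2 Q : set E, countable Q & dense Q.

(* The same carrier as E, with the Borel sigma-algebra. *)
Notation borelT E := (g_sigma_algebraType (@open E)).

(* The states 1, 2, 3, ... are encoded as 0, 1, 2, ... in nat, which carries
   the discrete sigma-algebra.
   The Borel space of actions is a Borel subset [actions] of a complete metric
   space E, to be used under the hypothesis [separable_space E].
   [trans] and [cost] are total functions, of which only the values on
   K = {(i, u) | u in U(i)} are ever used. *)
Record dtcmp (R : realType) (E : completeMetricType R) := DTCMP {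
  actions : set (borelT E) ;
  adm : nat -> set (borelT E) ;
  trans : nat * borelT E -> probability nat R ;
  cost : nat * borelT E -> R ;
  actions_borel : measurable actions ;
  adm_sub : forall i, adm i `<=` actions ;
  adm_nonempty : forall i, adm i !=set0 ;
  adm_borel : forall i, measurable (adm i) ;
  adm_compact : forall i, compact (adm i : set E) ;
  trans_measurable : forall A : set nat,
    measurable_fun [set x : nat * borelT E | adm x.1 x.2]
      (fun x => trans x A) ;
  cost_ge0 : forall i u, adm i u -> 0 <= cost (i, u)
}.

Section Model.
Context (R : realType) (E : completeMetricType R) (M : dtcmp E).

Definition stateaction : set (nat * borelT E) := [set x | adm M x.1 x.2].

(* A history (x_0, u_0, ..., x_{t-1}, u_{t-1}, x_t). *)
Definition history (t : nat) : Type := (t.-tuple (nat * borelT E) * nat)%type.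

Definition histories (t : nat) : set (t.-tuple (nat * borelT E) * nat) :=
  [set h | forall s : 'I_t, stateaction (tnth h.1 s)].
Arguments histories : clear implicits.

Definition control : Type := forall t : nat, history t -> borelT E.

Definition admissible (zeta : control) : Prop :=
  forall t : nat,
    measurable_fun (histories t)
      (zeta t : t.-tuple (nat * borelT E) * nat -> borelT E) /\
    (forall h, histories t h -> adm M h.2 (zeta t h)).

(* The stationary Markov controls; a map on the discrete set S is
   automatically measurable. *)
Definition stationary (v : nat -> E) : Prop := forall i, adm M i (v i).

Definition cylinders : set (set (nat -> nat * borelT E)) :=
  [set B | exists t : nat, exists2 A : set (nat * borelT E),
     measurable A & B = [set w | A (w t)]].

Definition pathspace := g_sigma_algebraType cylinders.

Definition hist_of (t : nat) (w : pathspace) :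
    t.-tuple (nat * borelT E) * nat :=
  ([tuple w s | s < t], (w t).1).

(* Under Pr, X_0 = i, the action at time t is zeta_t(h_t), and
   P(. | X_t, zeta_t) is the conditional law of X_{t+1} given h_t. *)
Definition is_law (i : nat) (zeta : control) (Pr : probability pathspace R) :
    Prop :=
  [/\ Pr [set w | (w 0%N).1 = i] = 1%E,
      {ae Pr, forall w, forall t, (w t).2 = zeta t (hist_of t w)} &
      forall t (B : set (t.-tuple (nat * borelT E) * nat)) (A : set nat),
        measurable B -> B `<=` histories t ->
        Pr [set w | B (hist_of t w) /\ A (w t.+1).1] =
        (\int[Pr]_(w in [set w | B (hist_of t w)])
           trans M ((w t).1, zeta t (hist_of t w)) A)%E].

(* For an admissible control such a law exists and is unique. *)
Definition law (i : nat) (zeta : control) : probability pathspace R :=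
  get (is_law i zeta).

(* The cost is defined on K only: the expectation is taken over the paths that
   stay in K, which have full measure. *)
Definition exp_cost (i : nat) (zeta : control) (T : nat) : \bar R :=
  (\int[law i zeta]_(w in [set w | forall t, stateaction (w t)])
     (expR (\sum_(t < T) cost M (w t)))%:E)%E.

(* The value at T = 0 is irrelevant for the limsup. *)
Definition risk_cost (i : nat) (zeta : control) : \bar R :=
  limn_esup (fun T : nat => ((T%:R^-1)%:E * lne (exp_cost i zeta T))%E).

Definition lambda_star : \bar R :=
  ereal_inf [set ereal_inf [set risk_cost i zeta | zeta in admissible]
            | i in [set: nat]].

Definition norm_like (g : nat -> R) : Prop :=
  forall kappa : R, finite_set [set i | g i <= kappa].

(* For a nonnegative f; the value may be +oo. *)
Definition transE (f : nat -> R) (i : nat) (u : E) : \bar R :=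
  (\sum_(0 <= j <oo) (f j)%:E * trans M (i, u) [set j])%E.

Definition condA : Prop :=
  forall i : nat,
    {within (adm M i : set E), continuous (fun u : E => cost M (i, u))} /\
    (forall f : nat -> R, (exists b : R, forall j, `|f j| <= b) ->
       {within (adm M i : set E), continuous (fun u : E =>
          limn (series (fun j => f j * fine (trans M (i, u) [set j]))))}).

Definition condB (i0 : nat) : Prop :=
  forall (j : nat) (u : E), j <> i0 -> adm M i0 u ->
    (0 < trans M (i0, u) [set j])%E.

Fixpoint nstep (v : nat -> E) (n : nat) (i j : nat) : \bar R :=
  if n is n'.+1 then
    (\sum_(0 <= k <oo) trans M (i, v i) [set k] * nstep v n' k j)%E
  else ((i == j)%:R)%:E.

Definition irreducible (v : nat -> E) : Prop :=
  forall i j, exists n : nat, (0 < nstep v n i j)%E.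

Definition La (V : nat -> R) (C : R) (Kf : set nat) : Prop :=
  exists beta : R,
    [/\ 0 < beta < 1,
        (forall i, (ereal_sup [set transE V i u | u in adm M i] <=
                    ((1 - beta) * V i + C * \1_Kf i)%:E)%E) &
        (ereal_sup [set (cost M x)%:E | x in stateaction] <
         (ln (1 / (1 - beta)))%:E)%E].

(* Under condition (A) the supremum is a maximum. *)
Definition cmax (i : nat) : R := sup [set cost M (i, u) | u in adm M i].

Definition Lb (V : nat -> R) (C : R) (Kf : set nat) : Prop :=
  exists ell : nat -> R,
    let beta i := 1 - expR (- ell i) in
    [/\ norm_like ell /\ (forall i, 0 <= ell i),
        (forall i, (ereal_sup [set transE V i u | u in adm M i] <=
                    (C * \1_Kf i + (1 - beta i) * V i)%:E)%E),
        norm_like (fun i => ell i - cmax i) &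
        exists2 eta : R, 0 < eta < 1 & forall i, cmax i <= eta * ell i].

Definition condL : Prop :=
  [/\ (forall v, stationary v -> irreducible v),
      (exists V : nat -> R, exists C : R, exists Kf : set nat,
        [/\ norm_like V, (forall i, 1 <= V i), 0 < C, finite_set Kf &
            La V C Kf \/ Lb V C Kf]) &
      exists z : nat, forall i,
        (0 < ereal_inf [set trans M (i, u) [set z] | u in adm M i])%E].

(* e^{c(i,u)} \sum_j f(j) P(j | i, u) *)
Definition twisted (f : nat -> R) (i : nat) (u : E) : \bar R :=
  ((expR (cost M (i, u)))%:E * transE f i u)%E.

Definition lambda1d (v : nat -> E) : \bar R :=
  ereal_inf [set lam%:E | lam in [set lam : R |
    exists Psi : nat -> R, (forall i, 0 < Psi i) /\
      forall i, (twisted Psi i (v i) <= (expR lam * Psi i)%:E)%E]].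

Definition argmin (F : E -> \bar R) (A : set E) : set E :=
  [set u | A u /\ forall u', A u' -> (F u <= F u')%E].

(* m is the minimum of F over A, and it is attained. *)
Definition is_min (m : \bar R) (F : E -> \bar R) (A : set E) : Prop :=
  (F @` A) m /\ lbound (F @` A) m.

Record policy_iteration (i0 : nat) (v : nat -> nat -> E) (lam : nat -> R)
    (V : nat -> nat -> R) : Prop := PolicyIteration {
  pi_stationary : forall k, stationary (v k) ;
  pi_lambda : forall k, (lam k)%:E = lambda1d (v k) ;
  pi_pos : forall k i, 0 < V k i ;
  pi_norm : forall k, V k i0 = 1 ;
  pi_poisson : forall k i,
    (expR (lam k) * V k i)%:E = twisted (V k) i (v k i) ;
  pi_improve : forall k i, argmin (twisted (V k) i) (adm M i) (v k.+1 i)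
}.

Definition hjb_solution (i0 : nat) (psi : nat -> R) : Prop :=
  [/\ (forall i, 0 < psi i), psi i0 = 1 &
      forall i, is_min (expeR lambda_star * (psi i)%:E)%E
                  (twisted psi i) (adm M i)].

End Model.

(* Main.v *)
Require Import Defs.
From mathcomp Require Import all_boot all_order all_algebra.
From mathcomp Require Import all_classical all_reals all_analysis.
From mathcomp Require Import measurable_realfun.
From mathcomp Require Import ring lra.
Set Implicit Arguments.
Unset Strict Implicit.
Unset Printing Implicit Defensive.
Import Order.TTheory GRing.Theory Num.Theory.
Import numFieldNormedType.Exports.
Local Open Scope classical_set_scope.
Local Open Scope ring_scope.

(** Fix a stationary control v.  The operator sending a positive function f to
    e^{c(i,v(i))} sum_j f(j) P(j|i,v(i)) is positive and, by irreducibility,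
    a nonnegative supersolution of its eigenvalue equation that vanishes at one
    state vanishes everywhere ([supersolution_vanish]).  The proof compares
    positive super- and subsolutions through this touching principle.

    Infinity is controlled by a power W = V^theta, theta < 1, of the Lyapunov
    function V of the drift condition ([exists_risk_lyapunov]).  For theta
    close to 1 the drift still beats the cost, so that off a finite set of
    states W is contracted under every action; and since W has lower order
    than V, the tails of sum_j W(j) P(j|i,u) are small uniformly in u, which
    makes the averages of functions dominated by W continuous in the action
    and in the function ([cvg_twisted]).  The contraction gives a comparison principle: a
    subsolution dominated by a multiple of W and a positive supersolution with
    the same nonnegative eigenvalue are proportional
    ([sub_super_proportional]).  It also shows that a positive supersolution
    for the smallest possible eigenvalue grows at most like W
    ([minimal_supersolution_growth]): its truncation by a multiple of W would
    otherwise be a supersolution that can be improved to a smaller eigenvalue.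

    The eigenvalues lam_k decrease, because V_k is a supersolution for v_{k+1}
    with eigenvalue lam_k; let l be their limit.  The state i0, from which all
    others are reached in one step, bounds each V_k(j) uniformly in k, hence
    V_k <= K W for one constant K.  Along any ultrafilter refining k -> oo,
    the functions V_k and V_{k+1} and the controls v_{k+1} converge to some f,
    f' and w; then f' is an eigenfunction and f a supersolution for the same
    control w and the same eigenvalue l.  By comparison f = f', and the
    optimality of v_{k+1} for V_k passes to the limit, so f solves the
    optimality equation with eigenvalue l ([ultra_limit_hjb]).  Comparison
    again shows that this equation has only one positive normalized solution
    ([hjb_unique]); as the limit does not depend on the ultrafilter, the whole
    sequence converges ([value_cvg]).

    It remains to identify l with the optimal value ([lambda_star_hjb]).  Let
    psi be the limit of the V_k.  A stationary selection of minimizers has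
    cost at most l, since psi + eps W is bounded away from 0 and is a
    supersolution for an eigenvalue close to l.  Under an arbitrary admissible
    control, E[e^{sum c} psi(X_T)] is at least e^{l T} psi(i), while the drift
    of W bounds E[e^{sum c} W(X_T)] by a constant multiple of E[e^{sum c}];
    hence no control does better than l.

    These expectations refer to the law of the controlled process, which has
    to be constructed ([law_exists]).  Controls are deterministic functions of
    the history, so that only the states are random; they are realized on
    [0, 1] with the uniform distribution, by repeatedly cutting intervals into
    pieces proportional to the transition probabilities. *)

(** * Averages over the next state *)

Section Averages.
Context (R : realType) (E : completeMetricType R) (M : dtcmp E).
Implicit Types (f g : nat -> R) (i j : nat) (u : E).

Definition weight i u j : R := fine (trans M (i, u) [set j]).

Lemma weightE i u j : trans M (i, u) [set j] = (weight i u j)%:E.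
Proof. by rewrite /weight fineK// fin_num_measure. Qed.

Lemma weight_ge0 i u j : 0 <= weight i u j.
Proof. by rewrite -lee_fin -weightE. Qed.

Lemma transE_ge0 f i u : (forall j, 0 <= f j) -> (0 <= transE M f i u)%E.
Proof. by move=> f0; apply: nneseries_ge0 => j _ _; rewrite mule_ge0 ?lee_fin. Qed.

Lemma le_transE f g i u : (forall j, 0 <= f j) -> (forall j, f j <= g j) ->
  (transE M f i u <= transE M g i u)%E.
Proof.
move=> f0 fg; apply: lee_nneseries => [j _ _|j _].
  by rewrite mule_ge0 ?lee_fin.
by rewrite lee_wpmul2r// lee_fin.
Qed.

Lemma transED f g i u : (forall j, 0 <= f j) -> (forall j, 0 <= g j) ->
  transE M (fun j => f j + g j) i u = (transE M f i u + transE M g i u)%E.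
Proof.
move=> f0 g0; rewrite /transE -nneseriesD; first last.
- by move=> j _ _; rewrite mule_ge0 ?lee_fin.
- by move=> j _ _; rewrite mule_ge0 ?lee_fin.
by apply: eq_eseriesr => j _; rewrite weightE -!EFinM -EFinD mulrDl.
Qed.

Lemma transEZ (a : R) f i u : (forall j, 0 <= f j) ->
  transE M (fun j => a * f j) i u = (a%:E * transE M f i u)%E.
Proof.
move=> f0; rewrite /transE -nneseriesZl; last first.
  by move=> j _; rewrite mule_ge0 ?lee_fin.
by apply: eq_eseriesr => j _; rewrite EFinM muleA.
Qed.

Lemma transE_cst (a : R) i u : transE M (fun=> a) i u = a%:E.
Proof.
rewrite /transE nneseriesZl//.
rewrite -measure_semi_bigcup//; last first.
  by apply/trivIsetP => k l _ _ /eqP kl; apply/seteqP; split => // x [/= -> /kl].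
have -> : \bigcup_n [set n] = [set: nat] by apply/seteqP; split => // n _; exists n.
by rewrite [X in (_ * X)%E](_ : _ = 1%E) ?mule1//; exact: probability_setT.
Qed.

Lemma transE_term f i u j : (forall j, 0 <= f j) ->
  ((f j * weight i u j)%:E <= transE M f i u)%E.
Proof.
move=> f0; have f1 k : (0 <= (f k)%:E * trans M (i, u) [set k])%E.
  by rewrite mule_ge0 ?lee_fin.
rewrite /transE (nneseriesD1 (n := j))// weightE -EFinM leeDl//.
exact: nneseries_ge0.
Qed.

Lemma twisted_ge0 f i u : (forall j, 0 <= f j) -> (0 <= twisted M f i u)%E.
Proof. by move=> f0; rewrite mule_ge0 ?lee_fin ?expR_ge0 ?transE_ge0. Qed.

Lemma le_twisted f g i u : (forall j, 0 <= f j) -> (forall j, f j <= g j) ->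
  (twisted M f i u <= twisted M g i u)%E.
Proof. by move=> f0 fg; rewrite lee_wpmul2l ?lee_fin ?expR_ge0 ?le_transE. Qed.

Lemma twistedD f g i u : (forall j, 0 <= f j) -> (forall j, 0 <= g j) ->
  twisted M (fun j => f j + g j) i u = (twisted M f i u + twisted M g i u)%E.
Proof.
by move=> f0 g0; rewrite /twisted transED// muleDr// ge0_adde_def// inE transE_ge0.
Qed.

Lemma twistedZ (a : R) f i u : (forall j, 0 <= f j) ->
  twisted M (fun j => a * f j) i u = (a%:E * twisted M f i u)%E.
Proof. by move=> f0; rewrite /twisted transEZ// muleCA. Qed.

Lemma twisted_cst (a : R) i u :
  twisted M (fun=> a) i u = (expR (cost M (i, u)) * a)%:E.
Proof. by rewrite /twisted transE_cst. Qed.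

Lemma transE_le_twisted f i u : adm M i u -> (forall j, 0 <= f j) ->
  (transE M f i u <= twisted M f i u)%E.
Proof.
move=> iu f0; rewrite -[X in (X <= _)%E]mul1e lee_wpmul2r ?transE_ge0 ?lee_fin//.
by rewrite -expR0 ler_expR cost_ge0.
Qed.

Lemma twisted_term f i u j : adm M i u -> (forall j, 0 <= f j) ->
  ((f j * weight i u j)%:E <= twisted M f i u)%E.
Proof. by move=> iu f0; rewrite (le_trans _ (transE_le_twisted _ _))// transE_term. Qed.

Lemma twisted_gt0 f i u : (forall j, 0 < f j) -> (0 < twisted M f i u)%E.
Proof.
move=> f0; rewrite lt_neqAle twisted_ge0 ?andbT; last by move=> j; apply/ltW.
apply/eqP => /esym /eqP.
rewrite mule_eq0 eqe gt_eqF ?expR_gt0//= => /eqP L0.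
have w0 j : weight i u j = 0.
  apply/eqP; rewrite eq_le weight_ge0 andbT.
  have := transE_term i u j (fun k => ltW (f0 k)).
  by rewrite L0 lee_fin pmulr_rle0.
have := transE_cst 1 i u; rewrite /transE eseries0; last first.
  by move=> k _ _; rewrite weightE w0 mule0.
by case => /esym/eqP; rewrite oner_eq0.
Qed.

Lemma nstep_succ_gt0 (v : nat -> E) n i j : (0 < nstep M v n.+1 i j)%E ->
  exists k, 0 < weight i (v i) k /\ (0 < nstep M v n k j)%E.
Proof.
have nge0 m k : (0 <= nstep M v m k j)%E.
  elim: m k => [k|m IH k] /=; first by rewrite lee_fin.
  by apply: nneseries_ge0 => l _ _; rewrite mule_ge0.
move=> /= h; apply: contrapT => /forallNP h1.
move: h; rewrite eseries0 ?ltxx// => k _ _.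
have [w0|w0] := leP (weight i (v i) k) 0.
  have -> : trans M (i, v i) [set k] = 0%E.
    by rewrite weightE; congr EFin; apply/eqP; rewrite eq_le w0 weight_ge0.
  by rewrite mul0e.
have [n0|n0] := leP (nstep M v n k j) 0%E.
  have -> : nstep M v n k j = 0%E by apply/eqP; rewrite eq_le n0 nge0.
  by rewrite mule0.
by have := h1 k; rewrite w0 n0 => /not_andP [].
Qed.

End Averages.

(** * Comparison of super- and subsolutions for a stationary control *)
Section Stationary.
Context (R : realType) (E : completeMetricType R) (M : dtcmp E).
Implicit Types (f g : nat -> R) (i j : nat) (u : E).

(** The exponential of the cost is included in the contraction outside
    {i | i < n0}; the finite exceptional set is taken to be an initial segment
    of the states.  The last field is uniform integrability of W under the
    one-step transitions from a given state. *)
Record risk_lyapunov (W : nat -> R) (n0 : nat) (r C : R) : Prop := RiskLyapunov {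
  lyap_ge1 : forall j, 1 <= W j ;
  lyap_n0 : (0 < n0)%N ;
  lyap_r : 0 < r < 1 ;
  lyap_C : 0 < C ;
  lyap_out : forall i u, adm M i u -> (n0 <= i)%N ->
    (twisted M W i u <= (r * W i)%:E)%E ;
  lyap_in : forall i u, adm M i u -> (i < n0)%N ->
    (twisted M W i u <= C%:E)%E ;
  lyap_tail : forall i (e : R), 0 < e -> exists N : nat, forall u, adm M i u ->
    (transE M (fun j => (N <= j)%:R * W j)%R i u <= e%:E)%E
}.

Lemma exists_pos_lb (x : nat -> R) n : (forall i, (i < n)%N -> 0 < x i) ->
  exists2 e, 0 < e & forall i, (i < n)%N -> e <= x i.
Proof.
elim: n => [|n IH] x0; first by exists 1.
have [i ltin|e e0 ex] := IH; first by apply: x0; rewrite ltnS ltnW.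
exists (Num.min e (x n)); first by rewrite lt_min e0 x0.
by move=> i; rewrite ltnS leq_eqVlt => /orP[/eqP ->|/ex ei]; rewrite ge_min ?ei ?lexx ?orbT.
Qed.

Lemma exists_ub (x : nat -> R) n :
  exists2 e, 0 < e & forall i, (i < n)%N -> x i <= e.
Proof.
elim: n => [|n [e e0 ex]]; first by exists 1.
exists (Num.max e (x n)); first by rewrite lt_max e0.
by move=> i; rewrite ltnS leq_eqVlt => /orP[/eqP ->|/ex ei]; rewrite le_max ?ei ?lexx ?orbT.
Qed.

(** The inequality that defines [lambda1d]. *)
Definition supersolution (v : nat -> E) (lam : R) f :=
  forall i, (twisted M f i (v i) <= (expR lam * f i)%:E)%E.

Definition subsolution (v : nat -> E) (lam : R) f :=
  forall i, ((expR lam * f i)%:E <= twisted M f i (v i))%E.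

Context (v : nat -> E) (sv : stationary M v).
Context (irr : irreducible M v).

(** At a zero of d the average of the nonnegative function d is zero, so d
    vanishes at all successors of that state; irreducibility reaches every
    state in this way. *)
Lemma supersolution_vanish lam d j0 : (forall j, 0 <= d j) ->
  supersolution v lam d -> d j0 = 0 -> forall j, d j = 0.
Proof.
move=> d0 dsup dj0 j; have [n] := irr j0 j.
elim: n j0 dj0 => [|n IH] i di.
  by rewrite /= lte_fin; case: eqP => [<-//|]; rewrite ltxx.
move=> /nstep_succ_gt0[k [wk nk]]; apply: (IH k) => //.
have := le_trans (twisted_term k (sv i) d0) (dsup i).
rewrite di mulr0 lee_fin => h; apply/eqP; rewrite eq_le d0 andbT.
by rewrite -(pmulr_lle0 _ wk).
Qed.

Context (W : nat -> R) (n0 : nat) (r C : R) (lyap : risk_lyapunov W n0 r C).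

Let W0 j : 0 < W j. Proof. exact: lt_le_trans (lyap_ge1 lyap j). Qed.
Let W0' j : 0 <= W j. Proof. exact: ltW. Qed.

Lemma geometric_le0 (a q K : R) : 0 <= q < 1 -> (forall n, a <= q ^+ n * K) ->
  a <= 0.
Proof.
move=> /andP[q0 q1] h.
have cv : q ^+ n * K @[n --> \oo] --> (0 : R).
  rewrite -[X in _ --> X](mul0r K); apply: cvgMl.
  by apply: cvg_expr; rewrite ger0_norm.
rewrite -(cvg_lim _ cv)//; apply: limr_ge; first by apply/cvg_ex; exists 0.
by apply: nearW.
Qed.

(** adding a small multiple of [W] to a positive supersolution *)
(** Outside the finite set the contraction of W leaves room, and on the finite
    set the gap between q and q' times the positive function psi absorbs a
    small multiple of the bound on W.  The gain is that psi + e W, unlike psi,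
    is bounded away from 0 and dominates a multiple of W. *)
Lemma add_lyapunov (q q' : R) psi : 0 < q -> q < q' -> r <= q' ->
  (forall j, 0 < psi j) ->
  (forall i, twisted M psi i (v i) <= (q * psi i)%:E)%E ->
  exists2 e, 0 < e & forall i,
    (twisted M (fun j => psi j + e * W j)%R i (v i) <=
       (q' * (psi i + e * W i))%:E)%E.
Proof.
move=> q0 qq' rq' psi0 psup.
have qd : 0 < q' - q by rewrite subr_gt0.
have [i _|e e0 he] := @exists_pos_lb (fun i => (q' - q) * psi i / C) n0.
  by rewrite divr_gt0 ?(lyap_C lyap)// mulr_gt0.
exists e => // i.
have /andP[r0 r1] := lyap_r lyap.
have p0 j : 0 <= psi j by apply/ltW.
have eW0 j : 0 <= e * W j by rewrite mulr_ge0// ltW.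
have e0' : (0 <= e%:E)%E by rewrite lee_fin ltW.
rewrite twistedD// twistedZ//.
have [ni|ni] := leqP n0 i.
  apply: (le_trans (leeD (psup i) (lee_wpmul2l e0' (lyap_out lyap (sv i) ni)))).
  rewrite -EFinM -EFinD lee_fin mulrDr lerD//.
    by rewrite ler_pM2r// ltW.
  by rewrite mulrCA ler_wpM2r.
apply: (le_trans (leeD (psup i) (lee_wpmul2l e0' (lyap_in lyap (sv i) ni)))).
rewrite -EFinM -EFinD lee_fin mulrDr.
have := he i ni; rewrite ler_pdivlMr ?(lyap_C lyap)// => h.
apply: (@le_trans _ _ (q' * psi i)); first by move: h; rewrite mulrBl; lra.
by rewrite lerDl mulr_ge0// (le_trans _ rq')// ltW.
Qed.

(** With a negative eigenvalue, psi + e W would be contracted by a factor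
    q' < 1 everywhere, the cost being nonnegative.  A lower bound m for this
    function then improves to m / q', since averages of constants are
    constants; iterating contradicts finiteness. *)
Lemma supersolution_lam_ge0 lam psi : (forall j, 0 < psi j) ->
  supersolution v lam psi -> 0 <= lam.
Proof.
move=> psi0 psup; rewrite leNgt; apply/negP => lam0.
have /andP[r0 r1] := lyap_r lyap.
have q1 : expR lam < 1 by rewrite -expR0 ltr_expR.
have [q' /andP[hq q'1]] : exists q', Num.max (expR lam) r < q' < 1.
  exists ((Num.max (expR lam) r + 1) / 2).
  have : Num.max (expR lam) r < 1 by rewrite gt_max q1.
  by move=> ?; apply/andP; split; lra.
move: hq; rewrite gt_max => /andP[hq1 hq2].
have q'0 : 0 < q' by apply: lt_trans hq2.
have [e e0 he] := add_lyapunov (expR_gt0 _) hq1 (ltW hq2) psi0 psup.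
set w := (fun j => psi j + e * W j) in he.
have w0 j : 0 <= w j by rewrite addr_ge0// ?mulr_ge0// ltW.
have lb n j : e <= q' ^+ n * w j.
  elim: n j => [|n IH] j.
    rewrite expr0 mul1r /w (@le_trans _ _ (e * W j))//.
      by rewrite ler_peMr ?(ltW e0)// (lyap_ge1 lyap).
    by rewrite lerDr ltW.
  have : ((e / q' ^+ n)%:E <= (q' * w j)%:E)%E.
    rewrite -(transE_cst M _ j (v j)); apply: le_trans (he j).
    apply: le_trans (transE_le_twisted (sv j) w0).
    apply: le_transE => k; first by rewrite divr_ge0 ?exprn_ge0 ?ltW.
    by rewrite ler_pdivrMr ?exprn_gt0// mulrC.
  by rewrite lee_fin ler_pdivrMr ?exprn_gt0// exprSr mulrC mulrA.
suff : e <= 0 by rewrite leNgt e0.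
apply: (@geometric_le0 _ q' (w 0%N)) => // ; by rewrite (ltW q'0).
Qed.

Lemma supersolutionB lam f g : (forall j, 0 <= f j <= g j) ->
  subsolution v lam f -> supersolution v lam g ->
  supersolution v lam (fun j => g j - f j).
Proof.
move=> fg fsub gsup i.
have f0 j : 0 <= f j by have /andP[] := fg j.
have d0 j : 0 <= g j - f j by rewrite subr_ge0; have /andP[] := fg j.
have := gsup i.
rewrite (_ : twisted M g i (v i) =
    twisted M f i (v i) + twisted M (fun j => g j - f j)%R i (v i))%E; last first.
  by rewrite -twistedD//; congr twisted; apply/funext => j; rewrite addrC subrK.
have := fsub i; have := twisted_ge0 M i (v i) f0; have := twisted_ge0 M i (v i) d0.
case: (twisted M f i (v i)) => [a| |]; case: (twisted M _ i (v i)) => [b| |]//=.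
by rewrite !lee_fin mulrBr; lra.
Qed.

(** Scale g so that a g touches f from above on the finite set i < n0.  Where
    W is contracted, an estimate f <= a g + s W improves to
    f <= a g + s r W because the eigenvalue is nonnegative; hence f <= a g
    everywhere, and the nonnegative supersolution a g - f has a zero. *)
Lemma sub_super_proportional lam f g K : 0 <= lam ->
  (forall j, 0 <= f j) -> (forall j, f j <= K * W j) -> (exists j, f j != 0) ->
  (forall j, 0 < g j) ->
  subsolution v lam f -> supersolution v lam g ->
  exists2 a, 0 < a & forall j, f j = a * g j.
Proof.
move=> lam0 f0 fK [k0 fk0] g0 fsub gsup.
have /andP[r0 r1] := lyap_r lyap.
have n00 := lyap_n0 lyap.
have K0 : 0 <= K by rewrite -(pmulr_lge0 K (W0 0)); exact: le_trans (f0 0%N) (fK 0%N).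
(* a is the maximum of f / g over i < n0, attained at j0. *)
have [a [j0 [j0n fa amax]]] : exists a, exists j0, [/\ (j0 < n0)%N, f j0 = a * g j0 &
    forall j, (j < n0)%N -> f j <= a * g j].
  have [i _ imax] := @arg_maxP _ _ 'I_n0 (Ordinal n00) xpredT
    (fun i : 'I_n0 => f i / g i) isT.
  exists (f i / g i), i; split => //; first by rewrite divfK// gt_eqF.
  by move=> j jn; rewrite -ler_pdivrMr//; exact: (imax (Ordinal jn)).
have a0 : 0 <= a by rewrite -(pmulr_lge0 a (g0 j0)) -fa.
have e1 : 1 <= expR lam by rewrite -expR0 ler_expR.
have iter n j : f j <= a * g j + K * r ^+ n * W j.
  elim: n j => [|n IH] j.
    by rewrite expr0 mulr1 (le_trans (fK j))// lerDr mulr_ge0// ltW.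
  have rn m : 0 <= K * r ^+ m by rewrite mulr_ge0// exprn_ge0// ltW.
  have [nj|jn] := leqP n0 j; last first.
    by rewrite (le_trans (amax j jn))// lerDl mulr_ge0.
  have h1 : (twisted M f j (v j) <=
      a%:E * (expR lam * g j)%:E + (K * r ^+ n)%:E * (r * W j)%:E)%E.
    apply: (le_trans (le_twisted M _ _ f0 IH)).
    rewrite twistedD; last 2 first.
    - by move=> k; rewrite mulr_ge0// ltW.
    - by move=> k; rewrite mulr_ge0.
    rewrite !twistedZ//; last by move=> k; apply/ltW.
    by rewrite leeD// lee_wpmul2l ?lee_fin// (lyap_out lyap).
  have := le_trans (fsub j) h1; rewrite -!EFinM -EFinD lee_fin.
  rewrite (mulrCA a) (mulrA (K * _) r) -(mulrA K) -exprSr => h2.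
  rewrite -(ler_pM2l (expR_gt0 lam)) mulrDr (le_trans h2)// lerD2l.
  by rewrite ler_peMl// mulr_ge0.
have fag j : f j <= a * g j.
  rewrite -subr_le0; apply: (@geometric_le0 _ r (K * W j)); first by rewrite (ltW r0).
  by move=> n; rewrite lerBlDl mulrCA mulrA.
have gsup' : supersolution v lam (fun j => a * g j).
  move=> i; rewrite twistedZ; last by move=> k; apply/ltW.
  by rewrite mulrCA EFinM lee_wpmul2l// lee_fin.
have fg j : 0 <= f j <= a * g j by rewrite f0 fag.
have ds := supersolutionB fg fsub gsup'.
have d0 j : 0 <= a * g j - f j by rewrite subr_ge0.
have fe j : f j = a * g j.
  apply/esym/eqP; rewrite -subr_eq0; apply/eqP.
  by apply: (supersolution_vanish (j0 := j0) d0 ds); rewrite fa subrr.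
exists a => //; rewrite lt_neqAle a0 andbT; apply: contraNN fk0 => /eqP az.
by rewrite fe -az mul0r.
Qed.


(** For lam = [lambda1d v], the half of the definition of the infimum that the
    growth estimate needs. *)
Definition minimal_lam lam := forall mu psi, (forall j, 0 < psi j) ->
  supersolution v mu psi -> lam <= mu.

(** Strictness on the finite set leaves room there for a small multiple of W,
    and off that set W itself is strictly contracted and dominates g; so g + e W
    is a supersolution for an eigenvalue smaller than lam. *)
Lemma strict_supersolution_absurd lam g K : 0 <= lam -> minimal_lam lam ->
  (forall j, 0 < g j) -> (forall j, g j <= K * W j) -> supersolution v lam g ->
  (forall i, (i < n0)%N -> (twisted M g i (v i) < (expR lam * g i)%:E)%E) ->
  False.
Proof.
move=> lam0 lmin g0 gK gsup gstr.
have /andP[r0 r1] := lyap_r lyap.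
have C0 := lyap_C lyap.
have g0' j : 0 <= g j by apply/ltW.
have K0 : 0 <= K by rewrite -(pmulr_lge0 K (W0 0)); exact: le_trans (g0' 0%N) (gK 0%N).
have e1 : 1 <= expR lam by rewrite -expR0 ler_expR.
pose t i := fine (twisted M g i (v i)).
have tE i : twisted M g i (v i) = (t i)%:E.
  rewrite fineK// ge0_fin_numE; last exact: twisted_ge0.
  by rewrite (le_lt_trans (gsup i))// ltry.
have [i ltin|s s0 hs] := @exists_pos_lb (fun i => expR lam * g i - t i) n0.
  by rewrite subr_gt0 -lte_fin -tE gstr.
have [G G0 hG] := exists_ub g n0.
(* With s the gap on the finite set, e uses up half of it.  The decrement d of
   the factor e^lam has to keep it positive, to fit into the other half on the
   finite set, and to be absorbed by the contraction of W outside. *)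
pose e := s / (2 * C).
have e0 : 0 < e by rewrite divr_gt0// mulr_gt0.
have eC : e * C = s / 2 by rewrite /e; field; rewrite gt_eqF.
pose d := Num.min (1 / 2) (Num.min (s / (2 * G)) (e * (1 - r) / (K + e))).
have Ke0 : 0 < K + e by rewrite ltr_wpDl.
have d0 : 0 < d.
  by rewrite !lt_min divr_gt0//= !divr_gt0// mulr_gt0// subr_gt0.
have d1 : d <= 1 / 2 by rewrite ge_min lexx.
have d2 : d * G <= s / 2.
  have : d <= s / (2 * G) by rewrite /d !ge_min lexx /= orbT.
  by rewrite ler_pdivlMr ?mulr_gt0//; lra.
have d3 : d * (K + e) <= e * (1 - r).
  by rewrite -ler_pdivlMr// /d !ge_min lexx !orbT.
have q0 : 0 < expR lam - d by lra.
suff : lam <= ln (expR lam - d).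
  by rewrite leNgt -ltr_expR lnK ?posrE// ltrBlDr ltrDl d0.
apply: (lmin _ (fun j => g j + e * W j)).
  by move=> j; rewrite addr_gt0// mulr_gt0.
move=> i; rewrite lnK ?posrE//.
have eW0 j : 0 <= e * W j by rewrite mulr_ge0// ltW.
have e0' : (0 <= e%:E)%E by rewrite lee_fin ltW.
rewrite twistedD// twistedZ//.
have [ni|ni] := leqP n0 i.
  apply: (le_trans (leeD (gsup i) (lee_wpmul2l e0' (lyap_out lyap (sv i) ni)))).
  rewrite -EFinM -EFinD lee_fin.
  have h1 : d * (g i + e * W i) <= e * (1 - r) * W i.
    apply: (@le_trans _ _ (d * (K + e) * W i)); last by rewrite ler_wpM2r.
    by rewrite -mulrA ler_wpM2l ?(ltW d0)// mulrDl lerD2r.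
  have h2 : 0 <= (expR lam - 1) * (e * W i) by rewrite mulr_ge0// subr_ge0.
  by move: h1 h2; rewrite !mulrBl !mulrBr !mulrDr; lra.
have lin := lee_wpmul2l e0' (lyap_in lyap (sv i) ni).
rewrite tE; apply: (le_trans (leeD (lexx _) lin)).
rewrite -EFinM -EFinD lee_fin eC.
have h1 := hs i ni.
have h2 : d * g i <= s / 2.
  by apply: le_trans d2; rewrite ler_wpM2l ?(ltW d0)// hG.
have h3 : 0 <= (expR lam - d) * (e * W i) by rewrite mulr_ge0// ltW.
by rewrite mulrDr; apply: ler_wpDr => //; rewrite mulrBl; lra.
Qed.

(** The eigenvalue equation is the fixed point equation of this map; it is
    real-valued, so that it can be iterated. *)
Definition normalized (lam : R) f i := expR (- lam) * fine (twisted M f i (v i)).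

Lemma normalizedE lam f i : (forall j, 0 <= f j) ->
  (twisted M f i (v i) \is a fin_num) ->
  twisted M f i (v i) = (expR lam * normalized lam f i)%:E.
Proof.
by move=> f0 ff; rewrite /normalized mulrA -expRD subrr expR0 mul1r fineK.
Qed.

Lemma supersolution_fin lam f i : (forall j, 0 <= f j) -> supersolution v lam f ->
  twisted M f i (v i) \is a fin_num.
Proof.
move=> f0 fsup; rewrite ge0_fin_numE; last exact: twisted_ge0.
by rewrite (le_lt_trans (fsup i))// ltry.
Qed.

Lemma normalized_supersolution lam f : (forall j, 0 < f j) ->
  supersolution v lam f ->
  [/\ forall j, 0 < normalized lam f j, forall j, normalized lam f j <= f j &
    supersolution v lam (normalized lam f)].
Proof.
move=> f0 fsup; have f0' j : 0 <= f j by apply/ltW.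
have qE i := normalizedE lam f0' (supersolution_fin i f0' fsup).
have q0 j : 0 < normalized lam f j.
  rewrite mulr_gt0 ?expR_gt0// fine_gt0// twisted_gt0//=.
  by have := supersolution_fin j f0' fsup; rewrite ge0_fin_numE// twisted_ge0.
have qf j : normalized lam f j <= f j.
  by rewrite -(ler_pM2l (expR_gt0 lam)) -lee_fin -qE; exact: fsup.
split=> // i; apply: (@le_trans _ _ (twisted M f i (v i))); last by rewrite qE.
by apply: le_twisted => // j; apply/ltW.
Qed.

(** Strictness of a supersolution at a successor state k is inherited at i by
    its image, because k carries positive weight in the average at i. *)
Lemma normalized_strict lam f i k : (forall j, 0 < f j) ->
  supersolution v lam f -> 0 < weight M i (v i) k ->
  normalized lam f k < f k ->
  normalized lam (normalized lam f) i < normalized lam f i.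
Proof.
move=> f0 fsup wk qk; have [q0 qf qsup] := normalized_supersolution f0 fsup.
have f0' j : 0 <= f j by apply/ltW.
have q0' j : 0 <= normalized lam f j by apply/ltW.
have d0 j : 0 <= f j - normalized lam f j by rewrite subr_ge0.
have h := twisted_term k (sv i) d0.
rewrite -(ltr_pM2l (expR_gt0 lam)) -!lte_fin -!normalizedE//; last 2 first.
- exact: supersolution_fin fsup.
- exact: supersolution_fin qsup.
rewrite [in X in (_ < X)%E](_ : f = (fun j => normalized lam f j +
    (f j - normalized lam f j))); last by apply/funext => j; rewrite addrC subrK.
 rewrite twistedD// lteDl ?(supersolution_fin i q0' qsup)//.
by apply: lt_le_trans h; rewrite lte_fin mulr_gt0// subr_gt0.
Qed.

(** The minimum h of f and K W is again a supersolution: off the finite set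
    as a minimum of two supersolutions, on it because h = f there.  If h is an
    exact solution, then f - h is a supersolution vanishing on the finite set,
    so f = h.  Otherwise h is strict at some state i1; following paths of
    positive probability that lead from each i < n0 to i1, iterates of h are
    strict at each such i, and their sum is excluded by
    [strict_supersolution_absurd]. *)
Lemma minimal_supersolution_growth lam f K : minimal_lam lam ->
  (forall j, 0 < f j) -> supersolution v lam f -> 0 < K ->
  (forall j, (j < n0)%N -> f j <= K * W j) ->
  forall j, f j <= K * W j.
Proof.
move=> lmin f0 fsup K0 fK.
have lam0 := supersolution_lam_ge0 f0 fsup.
have /andP[r0 r1] := lyap_r lyap.
have e1 : 1 <= expR lam by rewrite -expR0 ler_expR.
have f0' j : 0 <= f j by apply/ltW.
pose h j := Num.min (f j) (K * W j).
have h0 j : 0 < h j by rewrite lt_min f0 mulr_gt0.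
have h0' j : 0 <= h j by apply/ltW.
have hf j : h j <= f j by rewrite ge_min lexx.
have hK j : h j <= K * W j by rewrite ge_min lexx orbT.
have hsup : supersolution v lam h.
  move=> i; have [ni|ni] := leqP n0 i; last first.
    rewrite {2}/h (min_idPl (fK i ni)).
    exact: le_trans (le_twisted M i (v i) h0' hf) (fsup i).
  rewrite {2}/h; have [_|_] := leP (f i) (K * W i).
    exact: le_trans (le_twisted M i (v i) h0' hf) (fsup i).
  apply: le_trans (le_twisted M i (v i) h0' hK) _.
  rewrite twistedZ// mulrCA EFinM lee_wpmul2l ?lee_fin ?(ltW K0)//.
  apply: le_trans (lyap_out lyap (sv i) ni) _.
  by rewrite lee_fin ler_pM2r// ltW// (lt_le_trans r1).
have [exact|] := pselect (subsolution v lam h).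
  have fh j : 0 <= h j <= f j by rewrite h0' hf.
  have d0 j : 0 <= f j - h j by rewrite subr_ge0.
  have ds := supersolutionB fh exact fsup.
  move=> j; suff : f j - h j = 0 by move/subr0_eq ->.
  apply: (supersolution_vanish (j0 := 0%N) d0 ds).
  by rewrite /h (min_idPl (fK 0%N (lyap_n0 lyap))) subrr.
move=> /existsNP[i1 /negP]; rewrite -ltNge => hi1; exfalso.
pose Q := normalized lam.
have Qn n : [/\ forall j, 0 < iter n Q h j, forall j, iter n Q h j <= h j &
    supersolution v lam (iter n Q h)].
  elim: n => [|n [q0 qh qs]] //=.
  have [q0' qh' qs'] := normalized_supersolution q0 qs.
  by split => // j; apply: le_trans (qh j).
have strict n i : (0 < nstep M v n i i1)%E -> iter n.+1 Q h i < iter n Q h i.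
  elim: n i => [|n IH] i.
    rewrite /= lte_fin; case: eqP => [-> _|]; last by rewrite ltxx.
    rewrite -(ltr_pM2l (expR_gt0 lam)) -lte_fin -normalizedE//.
    exact: supersolution_fin hsup.
  move=> /nstep_succ_gt0[k [wk /IH nk]].
  have [q0 _ qs] := Qn n.
  by have := normalized_strict q0 qs wk nk.
have /choice[m hm] i : exists m, (0 < nstep M v m i i1)%E by exact: irr.
pose g n j := h j + \sum_(i < n) iter (m i) Q h j.
have gP n : [/\ forall j, 0 < g n j, forall j, g n j <= (n.+1)%:R * K * W j,
    supersolution v lam (g n) & forall i, (i < n)%N ->
      (twisted M (g n) i (v i) < (expR lam * g n i)%:E)%E].
  elim: n => [|n [g0 gK gs gstr]].
    rewrite (_ : g 0%N = h); last by apply/funext => j; rewrite /g big_ord0 addr0.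
    by split => // j; rewrite mul1r.
  have [q0 qh qs] := Qn (m n).
  have q0' j : 0 <= iter (m n) Q h j by apply/ltW.
  have g0' j : 0 <= g n j by apply/ltW.
  rewrite (_ : g n.+1 = fun j => g n j + iter (m n) Q h j); last first.
    by apply/funext => j; rewrite /g big_ord_recr /= addrA.
  split.
  - by move=> j; rewrite addr_gt0.
  - move=> j; rewrite -natr1 !mulrDl mul1r lerD//.
    exact: le_trans (qh j) (hK j).
  - by move=> i; rewrite twistedD// mulrDr EFinD leeD.
  move=> i; rewrite ltnS leq_eqVlt => /orP[/eqP ->|ltin];
    rewrite twistedD// mulrDr EFinD.
    apply: lee_ltD => //; first exact: supersolution_fin gs.
    rewrite (normalizedE lam)//; last exact: supersolution_fin qs.
    by rewrite lte_fin ltr_pM2l ?expR_gt0//; exact: strict (hm n).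
  apply: lte_leD => //; first exact: supersolution_fin qs.
  exact: gstr.
have [g0 gK gs gstr] := gP n0.
exact: strict_supersolution_absurd lam0 lmin g0 gK gs gstr.
Qed.

End Stationary.

(** * Lyapunov functions of lower order *)
Section LyapunovFunction.
Context (R : realType) (E : completeMetricType R) (M : dtcmp E).
Context (hA : condA M).
Implicit Types (f g : nat -> R) (i j : nat) (u : E).

Lemma finite_nat_ub (A : set nat) : finite_set A ->
  exists N : nat, forall j, A j -> (j < N)%N.
Proof.
move=> /finite_seqP[s ->]; exists (\max_(i <- s) i).+1 => j /= js.
by rewrite ltnS; exact: (@leq_bigmax_seq _ _ xpredT id).
Qed.

Lemma cost_ub i : exists b, forall u, adm M i u -> cost M (i, u) <= b.
Proof.
have [c _ hc] := compact_EVT_max (adm_nonempty M i) (@adm_compact _ _ M i) (hA i).1.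
by exists (cost M (i, c)) => u iu; apply: hc; rewrite inE.
Qed.

(** Weighted arithmetic-geometric mean inequality for e^{(t-1)b+x} and
    e^{tb}, from the tangent line of the exponential. *)
Lemma expR_tangent (t x b : R) : 0 <= t <= 1 ->
  expR (t * x) <= t * expR ((t - 1) * b + x) + (1 - t) * expR (t * b).
Proof.
move=> /andP[t0 t1].
have h (y : R) : expR (t * x) * (1 + (y - t * x)) <= expR y.
  rewrite [leRHS](_ : _ = expR (t * x) * expR (y - t * x)); last first.
    by rewrite -expRD addrC subrK.
  by rewrite ler_wpM2l ?expR_ge0// expR_ge1Dx.
have h1 := ler_wpM2l t0 (h ((t - 1) * b + x)).
have t1' : 0 <= 1 - t by rewrite subr_ge0.
have h2 := ler_wpM2l t1' (h (t * b)).
apply: le_trans (lerD h1 h2); rewrite le_eqVlt; apply/orP; left; apply/eqP; ring.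
Qed.

(** Jensen's inequality for the concave power y^t, written e^{t ln y}. *)
Lemma transE_power f i u (t a : R) : 0 <= t <= 1 -> 0 < a ->
  (forall j, 0 < f j) -> (transE M f i u <= a%:E)%E ->
  (transE M (fun j => expR (t * ln (f j))) i u <= (expR (t * ln a))%:E)%E.
Proof.
move=> t01 a0 f0 fa; have /andP[t0 t1] := t01.
pose b := ln a; pose k := t * expR ((t - 1) * b).
have k0 : 0 <= k by rewrite mulr_ge0// expR_ge0.
have f0' j : 0 <= f j by apply/ltW.
have c0 : 0 <= (1 - t) * expR (t * b) by rewrite mulr_ge0 ?expR_ge0// subr_ge0.
apply: (@le_trans _ _ (transE M (fun j => k * f j + (1 - t) * expR (t * b)) i u)).
  apply: le_transE => j; first exact: expR_ge0.
  by rewrite (le_trans (expR_tangent _ b t01))// expRD lnK ?posrE// mulrA.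
rewrite transED//; last by move=> j; rewrite mulr_ge0.
rewrite transEZ// transE_cst.
apply: (@le_trans _ _ (k%:E * a%:E + ((1 - t) * expR (t * b))%:E)%E).
  by rewrite leeD2r// lee_wpmul2l.
rewrite -EFinM -EFinD lee_fin /k -[X in _ * X + _](@lnK _ a) ?posrE// -/b.
rewrite -mulrA -expRD (_ : (t - 1) * b + b = t * b); last by ring.
by rewrite -mulrDl addrC subrK mul1r.
Qed.

(** Common form of the two drift conditions: V is multiplied by e^{-ell}, and
    t < 1 is so close to 1 that t * ell still exceeds the cost.  By Jensen's
    inequality W = V^t is multiplied by e^{-t ell}, so e^c times the average of
    W is at most e^{-d} W off a finite set.  Where V >= m the quotient
    W / V = V^{t-1} is at most m^{t-1}, which gives the uniform tails. *)
Lemma power_risk_lyapunov (V ell : nat -> R) (C t d : R) (Kf F0 : set nat) :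
  norm_like V -> (forall i, 1 <= V i) -> 0 < C -> finite_set Kf ->
  finite_set F0 -> 0 < t < 1 -> 0 < d ->
  (forall i u, adm M i u ->
     (transE M V i u <= (expR (- ell i) * V i + C * \1_Kf i)%:E)%E) ->
  (forall i u, adm M i u -> ~ F0 i -> cost M (i, u) - t * ell i <= - d) ->
  exists W n0 r C', risk_lyapunov M W n0 r C'.
Proof.
move=> Vnl V1 C0 Kfin Ffin /andP[t0 t1] d0 hV hc.
have V0 j : 0 < V j by apply: lt_le_trans (V1 j).
have t01 : 0 <= t <= 1 by rewrite !ltW.
pose W j := expR (t * ln (V j)).
have [n1 hn1] := finite_nat_ub Kfin; have [n2 hn2] := finite_nat_ub Ffin.
have /choice[cb hcb] := cost_ub.
pose a i := expR (- ell i) * V i + C.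
have a0 i : 0 < a i by rewrite addr_gt0// mulr_gt0// expR_gt0.
have haV i u : adm M i u -> (transE M V i u <= (a i)%:E)%E.
  move=> iu; apply: le_trans (hV i u iu) _; rewrite lee_fin lerD2l.
  by rewrite ler_piMr ?(ltW C0)// indicE; case: (_ \in _).
pose n0 := (maxn n1 n2).+1.
have [C' C'0 hC'] := exists_ub (fun i => expR (cb i) * expR (t * ln (a i))) n0.
exists W, n0, (expR (- d)), C'; split => //.
- by move=> j; rewrite -expR0 ler_expR mulr_ge0 ?ln_ge0// ltW.
- by rewrite expR_gt0 /= -expR0 ltr_expR oppr_lt0.
- move=> i u iu ni.
  have iK : ~ Kf i.
    by move=> /hn1; apply/negP; rewrite -leqNgt (leq_trans _ ni)// leqW// leq_maxl.
  have iF : ~ F0 i.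
    by move=> /hn2; apply/negP; rewrite -leqNgt (leq_trans _ ni)// leqW// leq_maxr.
  have := hV i u iu; rewrite indicE memNset// mulr0 addr0 => hVi.
  have e0 : 0 < expR (- ell i) * V i by rewrite mulr_gt0// expR_gt0.
  have := transE_power t01 e0 V0 hVi.
  rewrite lnM ?posrE ?expR_gt0// expRK => hW.
  rewrite /twisted.
  apply: le_trans (lee_wpmul2l _ hW) _; first by rewrite lee_fin expR_ge0.
  rewrite -EFinM lee_fin -expRD mulrDr addrA expRD ler_wpM2r ?expR_ge0// ler_expR.
  by rewrite mulrN; exact: hc.
- move=> i u iu ni.
  have hW := transE_power t01 (a0 i) V0 (haV i u iu).
  rewrite /twisted.
  apply: le_trans (lee_wpmul2l _ hW) _; first by rewrite lee_fin expR_ge0.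
  rewrite -EFinM lee_fin (le_trans _ (hC' i ni))// ler_wpM2r ?expR_ge0//.
  by rewrite ler_expR hcb.
move=> i e e0.
(* The level m solves m^{t-1} = e / a i. *)
pose m := expR (ln (e / a i) / (t - 1)).
have [N hN] := finite_nat_ub (Vnl m); exists N => u iu.
apply: (@le_trans _ _ (transE M (fun j => e / a i * V j) i u)).
  apply: le_transE => j; first by rewrite mulr_ge0// expR_ge0.
  have [Nj|_] := leqP N j; last by rewrite mul0r mulr_ge0// ltW// divr_gt0.
  rewrite mul1r /W.
  have mV : m <= V j.
    by rewrite leNgt; apply/negP => /ltW /hN; rewrite ltnNge Nj.
  rewrite -[X in _ <= _ * X](@lnK _ (V j)) ?posrE//.
  rewrite -[X in _ <= X * _](@lnK _ (e / a i)) ?posrE ?divr_gt0//.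
  rewrite -expRD ler_expR.
  have : ln (e / a i) / (t - 1) <= ln (V j).
    by rewrite -[leLHS]expRK ler_ln ?posrE ?expR_gt0.
  rewrite ler_ndivrMr ?subr_lt0//; lra.
rewrite transEZ; last by move=> j; rewrite ltW.
have ea0 : (0 <= (e / a i)%:E)%E by rewrite lee_fin divr_ge0 ?ltW.
apply: le_trans (lee_wpmul2l ea0 (haV i u iu)) _.
by rewrite -EFinM divfK// gt_eqF.
Qed.

(** In the first case ell is the constant gamma = - ln (1 - beta), and t is
    such that t gamma is the midpoint between the bound m on the cost and
    gamma.  In the second case t is the midpoint between eta and 1, and the
    exceptional set is where ell <= 1. *)
Lemma exists_risk_lyapunov : condL M ->
  exists W n0 r C, risk_lyapunov M W n0 r C.
Proof.
move=> [_ [V [C [Kf [Vnl V1 C0 Kfin hV]]]] _].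
case: hV => [[b [/andP[b0 b1] hb hcost]]|[ell [[ellnl ell0] hb _ [eta /andP[eta0 eta1] heta]]]].
- have [u0 iu0] := adm_nonempty M 0%N.
  set S := [set _ | _ in _] in hcost.
  have Sc i u : adm M i u -> ((cost M (i, u))%:E <= ereal_sup S)%E.
    by move=> iu; apply: ereal_sup_ubound; exists (i, u).
  have [m mE] : exists m, ereal_sup S = m%:E.
    have := Sc _ _ iu0; move: hcost; case: (ereal_sup S) => // m _ _; by exists m.
  move: hcost; rewrite mE lte_fin div1r.
  set ga := ln _ => mga.
  have m0 : 0 <= m.
    rewrite -lee_fin -mE (le_trans _ (Sc _ _ iu0))// lee_fin; exact: cost_ge0.
  have b1' : 0 < 1 - b by rewrite subr_gt0.
  have gaE : expR (- ga) = 1 - b by rewrite /ga lnV ?posrE// opprK lnK ?posrE.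
  have ga0 : 0 < ga by apply: le_lt_trans mga.
  apply: (@power_risk_lyapunov V (fun=> ga) C ((m + ga) / (2 * ga)) ((ga - m) / 2) Kf set0) => //.
  + apply/andP; split; first by rewrite divr_gt0 ?mulr_gt0// ltr_wpDl.
    by rewrite ltr_pdivrMr ?mulr_gt0//; lra.
  + by rewrite divr_gt0// subr_gt0.
  + move=> i u iu; rewrite gaE; apply: le_trans (hb i).
    by apply: ereal_sup_ubound; exists u.
  + move=> i u iu _; have := Sc _ _ iu; rewrite mE lee_fin => cm.
    rewrite (_ : (m + ga) / (2 * ga) * ga = (m + ga) / 2); first lra.
    by field; rewrite gt_eqF.
- apply: (@power_risk_lyapunov V ell C ((1 + eta) / 2) ((1 - eta) / 2) Kf [set i | ell i <= 1]) => //.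
  + by apply/andP; split; lra.
  + by rewrite divr_gt0// subr_gt0.
  + move=> i u iu; apply: le_trans (le_trans (_ : _ <= _)%E (hb i)) _.
      by apply: ereal_sup_ubound; exists u.
    by rewrite lee_fin addrC opprB addrCA subrr addr0.
  move=> i u iu /negP; rewrite -ltNge => ell1.
  have cE : cost M (i, u) <= eta * ell i.
    apply: le_trans (heta i); apply: ub_le_sup; last by exists u.
    by have [c hc] := cost_ub i; exists c => _ [w iw <-]; exact: hc.
  nra.
Qed.

End LyapunovFunction.

(** * Passing to the limit under the transition average *)
(** Ultrafilters replace the extraction of diagonal subsequences: along one
    ultrafilter, all the countably many sequences to be considered converge
    simultaneously. *)
Lemma ultra_compact_cvg (I : Type) (T : topologicalType) (U : set_system I)
    (x : I -> T) (A : set T) : UltraFilter U -> compact A -> (forall k, A (x k)) ->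
  exists2 l, A l & x k @[k --> U] --> l.
Proof.
move=> UU cA xA; have PU := @ultra_proper _ U UU.
have UA : (x @ U) A by apply: nearW => k; exact: xA.
have [l [Al cl]] := cA (x @ U) _ UA; exists l => // B Bl.
have [//|UB] := in_ultra_setVsetC (x @^-1` B) UU.
by have [y [/= nBy By]] := cl (~` B) B UB Bl.
Qed.

Section Limits.
Context (R : realType) (E : completeMetricType R) (M : dtcmp E).
Context (hA : condA M).
Implicit Types (f g : nat -> R) (i j : nat) (u : E).

(** The instance of the continuity assumption where f is the indicator of j. *)
Lemma weight_continuous i j :
  {within (adm M i : set E), continuous (fun u => weight M i u j)}.
Proof.
have [_ h] := hA i.
have {h} := h (fun k => (k == j)%:R) _.
rewrite (_ : (fun u : E => limn _) = (fun u => weight M i u j)).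
  by apply; exists 1 => k; rewrite normr_nat; case: (k == j).
apply/funext => u; apply: cvg_lim => //.
apply: cvg_near_cst; exists j.+1 => // n /= jn.
rewrite /series /= (bigD1_seq j) ?mem_index_iota ?iota_uniq//=.
by rewrite eqxx mul1r big1 ?addr0// => k /negbTE ->; rewrite mul0r.
Qed.

Lemma within_cvg (T : topologicalType) i (g : E -> T) (F : set_system nat)
    (FF : Filter F) (u_ : nat -> E) u :
  {within (adm M i : set E), continuous g} -> (forall k, adm M i (u_ k)) ->
  adm M i u -> u_ k @[k --> F] --> u -> g (u_ k) @[k --> F] --> g u.
Proof.
move=> /subspace_continuousP gc ua iu cu.
apply: cvg_comp (gc u iu) => B; rewrite /within /= => hB.
have h : F [set k | adm M i (u_ k) -> B (u_ k)] := cu _ hB.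
by rewrite /fmap /=; apply: (@filterS _ F _ _ _ _ h) => k /= hk; exact: hk (ua k).
Qed.

Lemma transE_split f N i u : (forall j, 0 <= f j) ->
  transE M f i u = ((\sum_(j < N) f j * weight M i u j)%:E +
    transE M (fun j => (N <= j)%:R * f j)%R i u)%E.
Proof.
move=> f0.
have g0 j : 0 <= (N <= j)%:R * f j by rewrite mulr_ge0.
rewrite /transE (nneseries_split 0 N); last by move=> k _; rewrite mule_ge0 ?lee_fin.
rewrite [in X in _ = (_ + X)%E](nneseries_split 0 N); last by move=> k _; rewrite mule_ge0 ?lee_fin.
rewrite add0n [X in _ = (_ + (X + _))%E](_ : _ = 0%E) ?add0e; last first.
  rewrite big_nat big1 // => j /andP[_ jN].
  by rewrite leqNgt jN mul0r mul0e.
congr (_ + _)%E.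
  rewrite big_mkord -sumEFin; apply: eq_bigr => j _.
  by rewrite weightE -EFinM.
rewrite [LHS]eseries_cond [RHS]eseries_cond.
by apply: eq_eseriesr => j /andP[_ Nj]; rewrite Nj mul1r.
Qed.

Context (W : nat -> R) (n0 : nat) (r C : R) (lyap : risk_lyapunov M W n0 r C).

Let W0 j : 0 < W j. Proof. exact: lt_le_trans (lyap_ge1 lyap j). Qed.
Let W0' j : 0 <= W j. Proof. exact: ltW. Qed.

Lemma twisted_fin f K i u : adm M i u -> (forall j, 0 <= f j <= K * W j) ->
  twisted M f i u \is a fin_num.
Proof.
move=> iu fK; have f0 j : 0 <= f j by have /andP[] := fK j.
have fK' j : f j <= K * W j by have /andP[] := fK j.
rewrite ge0_fin_numE; last exact: twisted_ge0.
apply: le_lt_trans (le_twisted M i u f0 fK') _.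
rewrite twistedZ//; have [ni|ni] := leqP n0 i.
  have := lyap_out lyap iu ni; have := twisted_ge0 M i u W0'.
  by case: (twisted M W i u) => // *; rewrite ltry.
have := lyap_in lyap iu ni; have := twisted_ge0 M i u W0'.
by case: (twisted M W i u) => // *; rewrite ltry.
Qed.

Lemma transE_fin f K i u : adm M i u -> (forall j, 0 <= f j <= K * W j) ->
  transE M f i u \is a fin_num.
Proof.
move=> iu fK; have f0 j : 0 <= f j by have /andP[] := fK j.
have := twisted_fin iu fK; rewrite !ge0_fin_numE ?twisted_ge0 ?transE_ge0//.
by apply: le_lt_trans; exact: transE_le_twisted.
Qed.

(** Domination by W and its uniform tails reduce the average to finitely many
    terms up to a small error that does not depend on k. *)
Lemma cvg_twisted (F : set_system nat) (FF : ProperFilter F) (f_ : nat -> nat -> R) f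
    (u_ : nat -> E) u i K : (forall k j, 0 <= f_ k j <= K * W j) ->
  (forall j, f_ k j @[k --> F] --> f j) ->
  (forall k, adm M i (u_ k)) -> adm M i u -> u_ k @[k --> F] --> u ->
  fine (twisted M (f_ k) i (u_ k)) @[k --> F] --> fine (twisted M f i u).
Proof.
move=> fK cf ua iu cu.
have f0 j : 0 <= f j.
  apply: (ler_cvg_to (cvg_cst 0) (cf j)).
  by apply: nearW => k; have /andP[] := fK k j.
have fle j : f j <= K * W j.
  apply: (ler_cvg_to (cf j) (cvg_cst (K * W j))).
  by apply: nearW => k; have /andP[] := fK k j.
have fK' j : 0 <= f j <= K * W j by rewrite f0 fle.
have K0 : 0 <= K by rewrite -(pmulr_lge0 K (W0 0)); exact: le_trans (f0 0%N) (fle 0%N).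
have tw g w : adm M i w -> (forall j, 0 <= g j <= K * W j) ->
    fine (twisted M g i w) = expR (cost M (i, w)) * fine (transE M g i w).
  by move=> iw gK; rewrite /twisted fineM//; exact: transE_fin gK.
rewrite tw// (_ : (fun k => _) = (fun k => expR (cost M (i, u_ k)) *
    fine (transE M (f_ k) i (u_ k)))); last by apply/funext => k; rewrite tw.
apply: cvgM.
  have cc : cost M (i, u_ k) @[k --> F] --> cost M (i, u).
    exact: (within_cvg _ (hA i).1).
  by apply: (continuous_cvg _ _ cc); exact: continuous_expR.
(* truncation: finitely many terms plus a uniformly small tail *)
have tail N e w g : (forall u, adm M i u ->
      (transE M (fun j => (N <= j)%:R * W j)%R i u <= e%:E)%E) ->
    adm M i w -> (forall j, 0 <= g j <= K * W j) ->
    0 <= fine (transE M g i w) - \sum_(j < N) g j * weight M i w j <= K * e.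
  move=> hN iw gK; have g0 j : 0 <= g j by have /andP[] := gK j.
  have t0 j : 0 <= (N <= j)%:R * g j by rewrite mulr_ge0.
  have tW0 j : 0 <= (N <= j)%:R * W j by rewrite mulr_ge0.
  have le1 : (transE M (fun j => (N <= j)%:R * g j)%R i w <= (K * e)%:E)%E.
    apply: (@le_trans _ _ (transE M (fun j => K * ((N <= j)%:R * W j)) i w)).
      by apply: le_transE => // j; rewrite mulrCA ler_wpM2l//; have /andP[] := gK j.
    by rewrite transEZ// EFinM lee_wpmul2l ?lee_fin// hN.
  have := transE_fin iw gK; rewrite (transE_split N i w g0).
  have := transE_ge0 M i w t0; move: le1.
  case: (transE M (fun j => _) i w) => // a; rewrite !lee_fin /= => h1 h2 _.
  by apply/andP; split; lra.
apply/cvgrPdist_lt => e e0.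
have e1 : 0 < e / (3 * (K + 1)) by rewrite divr_gt0// mulr_gt0// ltr_wpDl.
have [N hN] := lyap_tail lyap i e1.
have Ke : K * (e / (3 * (K + 1))) <= e / 3.
  have K1 : K + 1 != 0 by rewrite gt_eqF// ltr_wpDl.
  rewrite (_ : e / 3 = (K + 1) * (e / (3 * (K + 1)))); last by field.
  by rewrite ler_wpM2r ?(ltW e1)// lerDl.
have cs : \sum_(j < N) f_ k j * weight M i (u_ k) j @[k --> F] -->
    \sum_(j < N) f j * weight M i u j.
  elim: {hN} N => [|N IH].
    by rewrite big_ord0; under eq_fun do rewrite big_ord0; exact: cvg_cst.
  rewrite big_ord_recr /=; under eq_fun do rewrite big_ord_recr /=.
  apply: cvgD => //; apply: cvgM => //.
  exact: (within_cvg _ (@weight_continuous i N)).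
have e3 : 0 < e / 3 by rewrite divr_gt0.
move/cvgrPdist_lt: cs => /(_ _ e3); apply: filterS => k hk.
have /andP[a1 a2] := tail N _ _ _ hN iu fK'.
have /andP[b1 b2] := tail N _ _ _ hN (ua k) (fK k).
move: hk; rewrite !ltr_norml => /andP[h1 h2]; apply/andP; split; lra.
Qed.

End Limits.

(** * Limits of policy iteration *)
Section PolicyIterationLimit.
Context (R : realType) (E : completeMetricType R) (M : dtcmp E) (i0 : nat).
Context (hA : condA M) (hB : condB M i0).
Context (hirr : forall v, stationary M v -> irreducible M v).
Context (W : nat -> R) (n0 : nat) (r C : R) (lyap : risk_lyapunov M W n0 r C).
Context (v : nat -> nat -> E) (lam : nat -> R) (V : nat -> nat -> R).
Context (hPI : policy_iteration M i0 v lam V).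
Implicit Types (f g : nat -> R) (i j : nat) (u : E).

Let W0 j : 0 < W j. Proof. exact: lt_le_trans (lyap_ge1 lyap j). Qed.
Let W0' j : 0 <= W j. Proof. exact: ltW. Qed.

(** [hjb_solution] for an eigenvalue that is not yet known to be
    [lambda_star]. *)
Definition hjb (l : R) (psi : nat -> R) :=
  [/\ (forall i, 0 < psi i), psi i0 = 1 &
    forall i, is_min (expR l * psi i)%:E (twisted M psi i) (adm M i)].

(** For a control selecting minimizers for phi, phi is an exact solution and
    psi a subsolution. *)
Lemma hjb_unique l psi phi K : 0 <= l -> hjb l psi ->
  (forall j, psi j <= K * W j) -> hjb l phi -> phi = psi.
Proof.
move=> l0 [psi0 psi1 psim] psiK [phi0 phi1 phim].
have /choice[w hw] i : exists u, adm M i u /\ twisted M phi i u = (expR l * phi i)%:E.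
  by have [[u iu uE] _] := phim i; exists u.
have sw : stationary M w by move=> i; have [] := hw i.
have [a a0 ha] : exists2 a, 0 < a & forall j, psi j = a * phi j.
  apply: (sub_super_proportional sw (hirr sw) lyap l0 _ psiK) => //.
  - by move=> j; apply/ltW.
  - by exists i0; rewrite psi1 oner_neq0.
  - by move=> i; have [_] := psim i; apply; exists (w i).
  - by move=> i; have [_ ->] := hw i.
have a1 : a = 1 by have := ha i0; rewrite psi1 phi1 mulr1.
by apply/funext => j; rewrite ha a1 mul1r.
Qed.

Let V0 k j : 0 < V k j. Proof. exact: (pi_pos hPI). Qed.
Let V0' k j : 0 <= V k j. Proof. exact: ltW. Qed.

Lemma improved_supersolution k : supersolution M (v k.+1) (lam k) (V k).
Proof.
move=> i; rewrite /= (pi_poisson hPI).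
by have [_] := pi_improve hPI k i; apply; exact: (pi_stationary hPI).
Qed.

Lemma lam_minimal k : minimal_lam M (v k) (lam k).
Proof.
move=> mu psi psi0 psup; rewrite -lee_fin (pi_lambda hPI).
by apply: ereal_inf_lbound; exists mu => //; exists psi.
Qed.

Lemma lam_nonincreasing k : lam k.+1 <= lam k.
Proof. exact: (lam_minimal (V0 k) (improved_supersolution k)). Qed.

Lemma poisson_supersolution k : supersolution M (v k) (lam k) (V k).
Proof. by move=> i; rewrite (pi_poisson hPI). Qed.

Lemma lam_ge0 k : 0 <= lam k.
Proof.
exact: (supersolution_lam_ge0 (pi_stationary hPI k) lyap (V0 k)
  (@poisson_supersolution k)).
Qed.

Lemma lam_le k l : (k <= l)%N -> lam l <= lam k.
Proof.
by move=> kl; apply: (nonincreasing_seqP lam).1 kl; exact: lam_nonincreasing.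
Qed.

(** The Poisson equation at i0, where V_k = 1, bounds the contribution of each
    state j; the probability of j from i0 is bounded below by compactness of
    the set of actions. *)
Lemma value_pointwise_bound j : exists b, forall k, V k j <= b.
Proof.
have [->|/eqP ji] := eqVneq j i0.
  by exists 1 => k; rewrite (pi_norm hPI).
have [u ui hu] := compact_EVT_min (adm_nonempty M i0) (@adm_compact _ _ M i0)
  (weight_continuous hA (i := i0) (j := j)).
rewrite inE in ui.
have d0 : 0 < weight M i0 u j by rewrite -lte_fin -weightE; exact: hB.
exists (expR (lam 0%N) / weight M i0 u j) => k; rewrite ler_pdivlMr//.
have := twisted_term j (pi_stationary hPI k i0) (V0' k).
rewrite -(pi_poisson hPI) lee_fin (pi_norm hPI) mulr1 => h.
apply: (@le_trans _ _ (V k j * weight M i0 (v k i0) j)).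
  by rewrite ler_wpM2l// hu// inE; exact: (pi_stationary hPI).
by rewrite (le_trans h)// ler_expR lam_le.
Qed.

Lemma value_uniform_bound : exists2 K, 0 < K & forall k j, 0 <= V k j <= K * W j.
Proof.
have /choice[b hb] := value_pointwise_bound.
have [K K0 hK] := exists_ub b n0; exists K => // k j; rewrite V0'/=.
apply: (minimal_supersolution_growth (pi_stationary hPI k) _ lyap (@lam_minimal k)) => //.
- exact: hirr (pi_stationary hPI k).
- exact: poisson_supersolution.
move=> l ln; apply: le_trans (hb l k) (le_trans (hK l ln) _).
by rewrite ler_peMr ?(ltW K0)// (lyap_ge1 lyap).
Qed.

Lemma lam_cvg : exists2 l : R, 0 <= l & lam k @[k --> \oo] --> l.
Proof.
have c : cvgn lam.
  apply: nonincreasing_is_cvgn; first by move=> k l; exact: lam_le.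
  by exists 0 => _ [k _ <-]; exact: lam_ge0.
exists (limn lam) => //; apply: limr_ge => //.
by apply: nearW => k; exact: lam_ge0.
Qed.

(** The Poisson equation of index k+1 and the improvement inequality of index
    k involve the same control v_{k+1}.  In the limit they make f' a solution
    and f a supersolution for the same control w and, as lam_k converges, for
    the same eigenvalue.  Positivity of f is not inherited from V_k but follows
    from f i0 = 1 and irreducibility. *)
Lemma ultra_limit_hjb (U : set_system nat) (l K : R) : UltraFilter U -> \oo `<=` U ->
  0 <= l -> lam k @[k --> \oo] --> l -> (forall k j, 0 <= V k j <= K * W j) ->
  exists psi, [/\ hjb l psi, forall j, psi j <= K * W j &
    forall j, V k j @[k --> U] --> psi j].
Proof.
move=> UU ooU l0 cl VK; have PU := @ultra_proper _ U UU.
have clU : lam k @[k --> U] --> l by move=> B /cl hBn; exact: ooU.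
have clU1 : lam k.+1 @[k --> U] --> l.
  have cl1 : lam k.+1 @[k --> \oo] --> l by rewrite (cvg_shiftS lam).
  by move=> B /cl1 hBn; exact: ooU.
have lim01 (x : nat -> nat) j : exists y : R, 0 <= y <= K * W j /\ V (x k) j @[k --> U] --> y.
  have [y] := @ultra_compact_cvg _ R U (fun k => V (x k) j) _ UU
    (@segment_compact R 0 (K * W j)) (fun k => VK (x k) j).
  by move=> /= yK cy; exists y.
have /choice[f hf] := lim01 id; have /choice[f' hf'] := lim01 S.
have fK j : 0 <= f j <= K * W j by have [] := hf j.
have cf j : V k j @[k --> U] --> f j by have [] := hf j.
have fK' j : 0 <= f' j <= K * W j by have [] := hf' j.
have cf' j : V k.+1 j @[k --> U] --> f' j by have [] := hf' j.
have f0 j : 0 <= f j by have /andP[] := fK j.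
have f0' j : 0 <= f' j by have /andP[] := fK' j.
have /choice[w hw] i : exists u, adm M i u /\ v k.+1 i @[k --> U] --> u.
  have [u iu cu] := @ultra_compact_cvg _ E U (fun k => v k.+1 i) _ UU
    (@adm_compact _ _ M i) (fun k => pi_stationary hPI k.+1 i).
  by exists u.
have sw : stationary M w by move=> i; have [] := hw i.
have cw i : v k.+1 i @[k --> U] --> w i by have [] := hw i.
have va k i : adm M i (v k i) := pi_stationary hPI k i.
have fi0 : f i0 = 1.
  have c1 : V k i0 @[k --> U] --> (1 : R).
    by rewrite (_ : (fun k => _) = fun=> 1); [exact: cvg_cst|apply/funext => k; rewrite (pi_norm hPI)].
  exact: (cvg_unique _ (cf i0) c1).
have fi0' : f' i0 = 1.
  have c1 : V k.+1 i0 @[k --> U] --> (1 : R).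
    by rewrite (_ : (fun k => _) = fun=> 1); [exact: cvg_cst|apply/funext => k; rewrite (pi_norm hPI)].
  exact: (cvg_unique _ (cf' i0) c1).
have cexp (x : nat -> R) : x k @[k --> U] --> l -> expR (x k) @[k --> U] --> expR l.
  by move=> cx; apply: (continuous_cvg _ _ cx); exact: continuous_expR.
have fin_tw g i u : adm M i u -> (forall j, 0 <= g j <= K * W j) ->
    twisted M g i u = (fine (twisted M g i u))%:E.
  by move=> iu gK; rewrite fineK//; exact: (twisted_fin lyap iu gK).
have exact' i : twisted M f' i (w i) = (expR l * f' i)%:E.
  rewrite fin_tw//; congr EFin.
  have c1 := cvg_twisted hA lyap PU (fun k => VK k.+1) cf' (fun k => va k.+1 i) (sw i) (cw i).
  have c2 : fine (twisted M (V k.+1) i (v k.+1 i)) @[k --> U] --> expR l * f' i.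
    rewrite (_ : (fun k => _) = fun k => expR (lam k.+1) * V k.+1 i).
      by apply: cvgM => //; exact: cexp.
    by apply/funext => k; rewrite -(pi_poisson hPI).
  exact: (cvg_unique _ c1 c2).
have c2 i := cvg_twisted hA lyap PU VK cf (fun k => va k.+1 i) (sw i) (cw i).
have cV i : expR (lam k) * V k i @[k --> U] --> expR l * f i.
  by apply: cvgM => //; exact: cexp.
have fsup : supersolution M w l f.
  move=> i; rewrite fin_tw// lee_fin.
  apply: (ler_cvg_to (c2 i) (cV i)); apply: nearW => k.
  by rewrite -lee_fin -fin_tw//; exact: improved_supersolution.
have fpos j : 0 < f j.
  rewrite lt_neqAle f0 andbT; apply/eqP => fj.
  have := supersolution_vanish sw (hirr sw) f0 fsup (esym fj) i0.
  by rewrite fi0 => /eqP; rewrite oner_eq0.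
have ff' : f = f'.
  have [a a0 ha] : exists2 a, 0 < a & forall j, f' j = a * f j.
    apply: (@sub_super_proportional _ _ _ _ sw (hirr sw) _ _ _ _ lyap l _ _ K l0) => //.
    - by move=> j; have /andP[] := fK' j.
    - by exists i0; rewrite fi0' oner_neq0.
    - by move=> i; rewrite exact'.
  have a1 : a = 1 by have := ha i0; rewrite fi0 fi0' mulr1.
  by apply/funext => j; rewrite ha a1 mul1r.
exists f; split => //; last by move=> j; have /andP[] := fK j.
split => // i; split; first by exists (w i); rewrite ?exact' -?ff'// ff'.
move=> _ [u iu <-]; rewrite ff' -exact' -ff' fin_tw// [leRHS]fin_tw// lee_fin.
have cu : u @[_ --> U] --> u by exact: cvg_cst.
have c3 := cvg_twisted hA lyap PU VK cf (fun k => iu) iu cu.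
apply: (ler_cvg_to (c2 i) c3); apply: nearW => k.
rewrite -lee_fin -fin_tw// -fin_tw//.
by have [_] := pi_improve hPI k i; apply.
Qed.

(** If V_k(j) did not converge, some ultrafilter would keep it away from
    psi j; but its limit along that ultrafilter is a solution as well, hence
    equal to psi j. *)
Lemma value_cvg (l : R) : 0 <= l -> lam k @[k --> \oo] --> l ->
  exists psi K, [/\ hjb l psi, forall j, psi j <= K * W j &
    forall j, V k j @[k --> \oo] --> psi j].
Proof.
move=> l0 cl; have [K _ VK] := value_uniform_bound.
have [U [UU ooU]] := ultraFilterLemma (F := \oo) _.
have [psi [hpsi psiK _]] := ultra_limit_hjb UU ooU l0 cl VK.
exists psi, K; split => // j B Bpsi; apply: contrapT => nB.
pose D := [set k | ~ B (V k j)].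
have PG : ProperFilter (within D \oo).
  apply: Build_ProperFilter_ex => P hP; apply: contrapT => nP; apply: nB.
  have hDP : \forall k \near \oo, D k -> P k by exact: hP.
  suff : \forall k \near \oo, B (V k j) by [].
  apply: filterS hDP => k hk; apply: contrapT => Bk.
  by apply: nP; exists k; exact: hk.
have [U' [UU' GU']] := ultraFilterLemma PG.
have PU' := @ultra_proper _ U' UU'.
have ooU' : \oo `<=` U'.
  move=> P hP; apply: GU'; suff : \forall k \near \oo, D k -> P k by [].
  have : \forall k \near \oo, P k by exact: hP.
  by apply: filterS.
have [phi [hphi _ cphi]] := ultra_limit_hjb UU' ooU' l0 cl VK.
have pp := hjb_unique l0 hpsi psiK hphi.
have UB : U' [set k | B (V k j)] by have := cphi j B; rewrite pp; apply.
have UD : U' D.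
  by apply: GU'; suff : \forall k \near \oo, D k -> D k by []; apply: nearW.
by have [k [Bk Dk]] := filter_ex (filterI UB UD); exact: Dk Bk.
Qed.

End PolicyIterationLimit.

(** * Measurability on path and history spaces *)
Section Measurability.
Context (R : realType) (E : completeMetricType R) (M : dtcmp E).

Lemma measurable_coord t :
  measurable_fun [set: pathspace E] (fun w : pathspace E => w t : nat * borelT E).
Proof.
by move=> _ Y mY; rewrite setTI; apply: sub_sigma_algebra; exists t; exists Y.
Qed.

Lemma measurable_state t :
  measurable_fun [set: pathspace E] (fun w : pathspace E => (w t).1).
Proof. exact: (measurableT_comp measurable_fst (measurable_coord t)). Qed.

Lemma measurable_hist t : measurable_fun [set: pathspace E] (@hist_of R E t).
Proof.
apply: measurable_fun_pair; last exact: measurable_state.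
apply/measurable_fun_tnthP => s.
rewrite (_ : _ \o _ = fun w : pathspace E => w s); first exact: measurable_coord.
by apply/funext => w /=; rewrite tnth_mktuple.
Qed.

Lemma borel_measurable_set1 (u : borelT E) : measurable [set u].
Proof.
rewrite -[X in measurable X]setCK; apply: measurableC; apply: sub_sigma_algebra.
rewrite /= openC.
exact: (accessible_closed_set1 (hausdorff_accessible (@metric_hausdorff R E))).
Qed.

Lemma stateaction_set1_measurable (x : nat * borelT E) : measurable [set x].
Proof.
case: x => i u; rewrite (_ : [set (i, u)] = [set i] `*` [set u]).
  by apply: measurableX => //; exact: borel_measurable_set1.
by apply/seteqP; split=> [_ ->//|[j w] [/= -> ->]].
Qed.

Lemma measurable_tuple_forall t (P : 'I_t -> set (nat * borelT E)) :
  (forall s : 'I_t, measurable (P s)) ->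
  measurable [set h : t.-tuple (nat * borelT E) | forall s, P s (tnth h s)].
Proof.
move=> mP.
rewrite (_ : mkset _ = \bigcap_(s in [set: 'I_t]) ((fun h => tnth h s) @^-1` P s)).
  apply: fin_bigcap_measurable => // s _.
  by rewrite -[X in measurable X]setTI; apply: (measurable_tnth s).
by apply/seteqP; split=> h hh s; [move=> _; exact: hh|exact: hh s I].
Qed.

Lemma history_set1_measurable t (h : t.-tuple (nat * borelT E) * nat) :
  measurable [set h].
Proof.
rewrite (_ : [set h] = [set g : t.-tuple (nat * borelT E) | forall s,
    [set tnth h.1 s] (tnth g s)] `*` [set h.2]).
  apply: measurableX => //.
  apply: (measurable_tuple_forall (P := fun s => [set tnth h.1 s])) => s.
  exact: stateaction_set1_measurable.
apply/seteqP; split=> [_ ->//|[g j] [/= gh ->]].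
by case: h gh => h1 h2 /= gh; congr pair; apply: eq_from_tnth.
Qed.

Lemma stateaction_measurable : measurable (stateaction M).
Proof.
rewrite (_ : stateaction M = \bigcup_i ([set i] `*` adm M i)).
  by apply: bigcupT_measurable => i; apply: measurableX => //; exact: adm_borel.
by apply/seteqP; split=> [[i u] /= iu|[i u] [j _ [/= -> ]]] //; exists i.
Qed.

Lemma histories_measurable t : measurable (@histories R E M t).
Proof.
rewrite (_ : @histories R E M t = [set g : t.-tuple (nat * borelT E) | forall s,
    stateaction M (tnth g s)] `*` [set: nat]).
  apply: measurableX => //.
  apply: (measurable_tuple_forall (P := fun=> stateaction M)) => s.
  exact: stateaction_measurable.
by apply/seteqP; split=> [h hh|h [hh _]]; [split|].
Qed.

Context (hA : condA M).

(** Continuity on the compact set of actions of each of the countably many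
    states is enough. *)
Lemma cost_measurable : measurable_fun (stateaction M) (cost M).
Proof.
rewrite (_ : stateaction M = \bigcup_i ([set i] `*` adm M i)); last first.
  by apply/seteqP; split=> [[i u] /= iu|[i u] [j _ [/= -> ]]] //; exists i.
have mi i : measurable ([set i] `*` adm M i).
  by apply: measurableX => //; exact: adm_borel.
apply/measurable_fun_bigcup => // i.
have mc : measurable_fun (adm M i) (fun u : borelT E => cost M (i, u)).
  apply: (measurability _ (RGenOpens.measurableE R)).
  move=> _ [_ [a [b ->]] <-].
  have cc := (hA i).1; move/continuousP : cc => cc.
  have oab : open `]a, b[%classic by exact: interval_open.
  have /open_subspaceP [G oG GE] := cc _ oab.
  rewrite (_ : _ `&` _ = G `&` adm M i); last by rewrite GE setIC.
  by apply: measurableI; [exact: sub_sigma_algebra|exact: adm_borel].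
move=> mD Y mY.
rewrite (_ : _ `&` _ = [set i] `*` (adm M i `&` (fun u => cost M (i, u)) @^-1` Y)).
  by apply: measurableX => //; apply: mc => //; exact: adm_borel.
by apply/seteqP; split=> [[j u] [[/= -> iu] cY]|[j u] [/= -> [iu cY]]].
Qed.

End Measurability.

(** * Paths following a deterministic control *)
Section ControlledPaths.
Context (R : realType) (E : completeMetricType R) (M : dtcmp E).
Context (zeta : control E).
Implicit Types (y : nat -> nat) (w : nat -> nat * borelT E).

(** The history produced by [zeta] when the states are those of y.  Almost
    every path is determined in this way by its states, which reduces the path
    space to sequences of states. *)
Fixpoint chist y (t : nat) : t.-tuple (nat * borelT E) * nat :=
  if t is s.+1 then
    ([tuple of rcons (chist y s).1 ((chist y s).2, zeta (chist y s))], y s.+1)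
  else ([tuple], y 0).

Definition cact y t : borelT E := zeta (chist y t).

Definition cpath y t : nat * borelT E := (y t, cact y t).

Definition states w : nat -> nat := fun t => (w t).1.

Lemma chist2 y t : (chist y t).2 = y t.
Proof. by case: t. Qed.

Lemma chist_local y y' t : (forall s, (s <= t)%N -> y s = y' s) ->
  chist y t = chist y' t.
Proof.
elim: t => [|t IH] h /=; first by rewrite h.
by rewrite IH ?h// => s st; rewrite h// ltnW.
Qed.

Lemma cpath_local y y' t : (forall s, (s <= t)%N -> y s = y' s) ->
  cpath y t = cpath y' t.
Proof. by move=> h; rewrite /cpath /cact (chist_local h) h. Qed.

Lemma hist_ofS t (w : pathspace E) :
  hist_of t.+1 w = ([tuple of rcons (hist_of t w).1 (w t)], (w t.+1).1).
Proof.
have mapE n : [seq w (nat_of_ord s) | s <- enum 'I_n] = [seq w s | s <- iota 0 n].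
  by rewrite -val_enum_ord -map_comp.
congr pair; apply: val_inj => /=.
by rewrite !mapE -addn1 iotaD map_cat /= cats1.
Qed.

Lemma hist_of_follow (w : pathspace E) t :
  (forall s, (w s).2 = zeta (hist_of s w)) -> hist_of t w = chist (states w) t.
Proof.
move=> wz; elim: t => [|t IH].
  by congr pair; apply: eq_from_tnth => -[].
rewrite hist_ofS IH [RHS]/=; congr pair; apply: val_inj => /=; congr rcons.
by rewrite chist2 -IH -wz /states -surjective_pairing.
Qed.

Lemma follow_cpath (w : pathspace E) t :
  (forall s, (w s).2 = zeta (hist_of s w)) -> w t = cpath (states w) t.
Proof.
by move=> wz; rewrite /cpath /cact -hist_of_follow// -wz /states -surjective_pairing.
Qed.

Lemma hist_of_cpath y t : hist_of t (cpath y : pathspace E) = chist y t.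
Proof.
elim: t => [|t IH]; first by congr pair; apply: eq_from_tnth => -[].
rewrite hist_ofS IH [RHS]/=; congr pair; apply: val_inj => /=.
by rewrite chist2.
Qed.

Lemma chist_states (w : pathspace E) y t : hist_of t w = chist y t ->
  forall s, (s <= t)%N -> states w s = y s.
Proof.
elim: t => [|t IH].
  by move=> /(congr1 snd) /= wy s; rewrite leqn0 => /eqP ->.
rewrite hist_ofS => -[] /= hr hl s; rewrite leq_eqVlt => /orP[/eqP ->//|].
have : rcons (hist_of t w).1 (w t) =
   rcons (chist y t).1 ((chist y t).2, zeta (chist y t)) by [].
move=> /rcons_inj[h1 h2]; rewrite ltnS; apply: IH.
apply/eqP; rewrite -pair_eqE /pair_eq /=; apply/andP; split.
  by apply/eqP; apply: val_inj.
by rewrite h2 chist2.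
Qed.

Context (az : admissible M zeta).

Lemma chist_histories y t : histories M (chist y t).
Proof.
elim: t => [|t IH]; first by case.
move=> s /=; rewrite (tnth_nth (0%N, point)) /= nth_rcons size_tuple.
have [st|ts] := ltnP s t.
  by have := IH (Ordinal st); rewrite (tnth_nth (0%N, point)).
have -> : (s == t :> nat) by rewrite eqn_leq ts -ltnS ltn_ord.
by rewrite /stateaction /=; have [_] := az t; apply.
Qed.

Lemma cpath_stateaction y t : stateaction M (cpath y t).
Proof.
rewrite /stateaction /= /cact -[y t]chist2.
by have [_] := az t; apply; exact: chist_histories.
Qed.

End ControlledPaths.

(** * Discrete-valued processes *)
Lemma eq_measure_null d (T : measurableType d) (R : realType) (P : probability T R)
    (N A B : set T) :
  measurable N -> P N = 0%E -> measurable A -> measurable B ->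
  B `<=` A -> A `<=` B `|` N -> P A = P B.
Proof.
move=> mN N0 mA mB BA AB; apply/eqP; rewrite eq_le; apply/andP; split; last first.
  by apply: le_measure; rewrite ?inE.
apply: (@le_trans _ _ (P (B `|` N))).
  by apply: le_measure; rewrite ?inE//; exact: measurableU.
by apply: le_trans (measureU2 P mB mN) _; rewrite [X in (_ + X)%E]N0 adde0.
Qed.

Section StateProcess.
Context d (T : measurableType d) (R : realType) (P : probability T R).
Context (Y : nat -> T -> nat) (mY : forall t, measurable_fun [set: T] (Y t)).

Definition agree (y : nat -> nat) t : set T :=
  [set w | forall s, (s <= t)%N -> Y s w = y s].

Lemma agree_measurable y t : measurable (agree y t).
Proof.
rewrite (_ : agree y t = \bigcap_(s in [set s | (s <= t)%N]) (Y s @^-1` [set y s])).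
  apply: bigcap_measurableType => s _.
  by rewrite -[X in measurable X]setTI; exact: mY.
by apply/seteqP; split => w.
Qed.

(** Integrals are computed by cutting the space into the countably many events
    on which this code is constant. *)
Definition code t w : nat := pickle (mkseq (Y^~ w) t.+1).

Lemma codeP t w w' : code t w = code t w' <->
  forall s, (s <= t)%N -> Y s w = Y s w'.
Proof.
split=> [/(pcan_inj pickleK) h s st|h].
  have := congr1 (nth 0 ^~ s) h; rewrite !nth_mkseq ?ltnS//.
by congr pickle; apply/eq_in_map => s; rewrite mem_iota /= add0n => /h.
Qed.

Lemma codeE t w0 : [set w | code t w = code t w0] = agree (Y^~ w0) t.
Proof. by apply/seteqP; split => w /codeP. Qed.

Lemma code_measurable t n : measurable [set w | code t w = n].
Proof.
have [[w0 <-]|/nonemptyPn ->] := pselect ([set w | code t w = n] !=set0).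
  by rewrite codeE; exact: agree_measurable.
exact: measurable0.
Qed.

Definition local_upto t (U : Type) (f : T -> U) :=
  forall w w', (forall s, (s <= t)%N -> Y s w = Y s w') -> f w = f w'.

Lemma local_measurable t d' (U : measurableType d') (f : T -> U) :
  local_upto t f -> measurable_fun [set: T] f.
Proof.
move=> fl _ B mB; rewrite setTI.
rewrite (_ : f @^-1` B = \bigcup_(n in [set n | exists2 w, B (f w) & code t w = n])
   [set w | code t w = n]).
  by apply: bigcup_measurable => n _; exact: code_measurable.
apply/seteqP; split => [w Bw|w [n [w0 Bw0 <-] /codeP h]] /=.
  by exists (code t w) => //; exists w.
by rewrite (fl _ _ h).
Qed.

Lemma partition_integral (N : T -> nat) (D : set T) (f : T -> \bar R) :
  (forall n, measurable (D `&` [set w | N w = n])) -> measurable D ->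
  measurable_fun D f -> (forall w, D w -> (0 <= f w)%E) ->
  (\int[P]_(w in D) f w = \sum_(0 <= n <oo) \int[P]_(w in D `&` [set w | N w = n]) f w)%E.
Proof.
move=> mN mD mf f0.
have DE : \bigcup_n (D `&` [set w | N w = n]) = D.
  by apply/seteqP; split => [w [n _ []]|w Dw] //; exists (N w).
rewrite -[X in (\int[P]_(w in X) _)%E]DE ge0_integral_bigcup ?DE//.
apply/trivIsetP => n m _ _ /eqP nm; apply/seteqP; split => // w.
by move=> [[_ /= wn] [_ /= wm]]; apply: nm; rewrite -wn.
Qed.

Context (kappa : (nat -> nat) -> nat -> probability nat R).
Context (kappa_local : forall t, local_upto t (fun w => kappa (Y^~ w) t)).
Context (markov : forall y t j,
  P (agree y t `&` [set w | Y t.+1 w = j]) = (P (agree y t) * kappa y t [set j])%E).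

(** On each of the countably many events fixing the states up to time t, F is
    constant and the law of the next state is [kappa], so both sides can be
    computed event by event. *)
Lemma one_step_integral t (F : T -> \bar R) (G : nat -> \bar R) :
  local_upto t F -> (forall w, (0 <= F w)%E) -> (forall j, (0 <= G j)%E) ->
  (\int[P]_w (F w * G (Y t.+1 w)) =
   \int[P]_w (F w * \sum_(0 <= j <oo) G j * kappa (Y^~ w) t [set j]))%E.
Proof.
move=> Fl F0 G0.
have ml : local_upto t.+1 (fun w => F w * G (Y t.+1 w))%E.
  by move=> w w' h; rewrite (Fl w w') ?h// => s st; rewrite h// ltnW.
pose S y := (\sum_(0 <= j <oo) G j * kappa y t [set j])%E.
have S0 y : (0 <= S y)%E by apply: nneseries_ge0 => j _ _; rewrite mule_ge0.
have mr : local_upto t (fun w => F w * S (Y^~ w))%E.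
  by move=> w w' h; rewrite (Fl w w') /S ?(kappa_local h).
have mD n : measurable ([set: T] `&` [set w | code t w = n]).
  by rewrite setTI; exact: code_measurable.
rewrite (@partition_integral (code t))//; last 2 first.
- exact: local_measurable ml.
- by move=> w _; rewrite mule_ge0.
rewrite [RHS](@partition_integral (code t))//; last 2 first.
- exact: local_measurable mr.
- by move=> w _; exact: mule_ge0 (F0 w) (S0 _).
apply: eq_eseriesr => n _; rewrite setTI.
have [[w0 <-]|/nonemptyPn ->] := pselect ([set w | code t w = n] !=set0); last first.
  by rewrite !integral_set0.
rewrite codeE; set A := agree _ _.
have mA : measurable A by exact: agree_measurable.
have FA w : w \in A -> F w = F w0 by rewrite inE => hw; apply: Fl.
have SA w : w \in A -> S (Y^~ w) = S (Y^~ w0).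
  by rewrite inE => hw; rewrite /S (kappa_local (w' := w0)).
rewrite (eq_integral (fun w => F w0 * G (Y t.+1 w))%E); last by move=> w /FA ->.
rewrite [RHS](eq_integral (fun w => F w0 * S (Y^~ w0))%E); last first.
  by move=> w wA; rewrite FA// -(SA w wA).
have mG : measurable_fun [set: T] (fun w => G (Y t.+1 w)).
  by apply: (@local_measurable t.+1) => w w' ->.
rewrite ge0_integralZl//; last exact: measurable_funTS.
rewrite [RHS]integral_cst// -muleA; congr (_ * _)%E.
have mY1 j : measurable (A `&` [set w | Y t.+1 w = j]).
  apply: measurableI => //; rewrite (_ : mkset _ = Y t.+1 @^-1` [set j])//.
  by rewrite -[X in measurable X]setTI; exact: mY.
rewrite (@partition_integral (Y t.+1))//; last exact: measurable_funTS.
have [p pE] : exists p : R, P A = p%:E.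
  by exists (fine (P A)); rewrite fineK// fin_num_measure.
rewrite [X in _ = (_ * X)%E]pE muleC -nneseriesZl; last by move=> j _; rewrite mule_ge0.
apply: eq_eseriesr => j _.
rewrite (eq_integral (fun=> G j)); last by move=> w; rewrite inE => -[_ /= ->].
rewrite integral_cst// [X in (_ * X)%E = _](markov (Y^~ w0) t j).
by rewrite [X in (_ * (X * _))%E = _]pE muleCA.
Qed.

End StateProcess.

(** * Expectations under the law of a controlled process *)
Section LawConsequences.
Context (R : realType) (E : completeMetricType R) (M : dtcmp E).
Context (hA : condA M) (zeta : control E) (az : admissible M zeta) (i : nat).
Context (Pr : probability (pathspace E) R) (hl : is_law M i zeta Pr).

Let Y t (w : pathspace E) : nat := (w t).1.
Let kappa y t := trans M (cpath zeta y t).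

Lemma follow_null : exists N, [/\ measurable N, Pr N = 0%E &
  forall w : pathspace E, ~ N w -> forall s, (w s).2 = zeta (hist_of s w)].
Proof.
have [_ [N [mN N0 hN]] _] := hl; exists N; split => // w nN.
by apply: contrapT => h; apply: nN; apply: hN.
Qed.

(** Up to a null set, prescribing the states up to time t is the same as
    prescribing the history [chist zeta y t]; on this single history the
    integrand in the definition of the law is constant. *)
Lemma law_markov y t j :
  Pr (agree Y y t `&` [set w | Y t.+1 w = j]) =
  (Pr (agree Y y t) * kappa y t [set j])%E.
Proof.
have [N [mN N0 hN]] := follow_null.
have mstate s : measurable_fun [set: pathspace E] (Y s) := measurable_state (E := E) s.
pose H := [set w : pathspace E | hist_of t w = chist zeta y t].
have mH : measurable H.
  rewrite (_ : H = @hist_of R E t @^-1` [set chist zeta y t])//.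
  rewrite -[X in measurable X]setTI; apply: measurable_hist => //.
  exact: history_set1_measurable.
have mJ : measurable [set w | Y t.+1 w = j].
  rewrite (_ : mkset _ = Y t.+1 @^-1` [set j])//.
  by rewrite -[X in measurable X]setTI; exact: mstate.
have HA : H `<=` agree Y y t by move=> w hw s st; exact: (chist_states hw).
have AH : agree Y y t `<=` H `|` N.
  move=> w hw; have [Nw|nN] := pselect (N w); [by right|left].
  by rewrite /H /= (hist_of_follow t (hN w nN)); exact: chist_local.
have mA := agree_measurable mstate y t.
have mAJ := measurableI _ _ mA mJ; have mHJ := measurableI _ _ mH mJ.
rewrite (eq_measure_null mN N0 mA mH HA AH) (eq_measure_null mN N0 mAJ mHJ)//;
  last 2 first.
- by move=> w [/HA].
- by move=> w [/AH [Hw|Nw] jw]; [left|right].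
have [_ _ h] := hl.
have := h t [set chist zeta y t] [set j] (history_set1_measurable _).
have -> : [set w : pathspace E | [set chist zeta y t] (hist_of t w) /\ [set j] (w t.+1).1] =
  H `&` [set w | Y t.+1 w = j] by [].
move=> ->; last by move=> _ ->; exact: chist_histories.
rewrite (eq_integral (fun=> kappa y t [set j])); last first.
  move=> w; rewrite inE => hw; rewrite /kappa /cpath /cact; congr (trans M _ _).
  have <- : hist_of t w = chist zeta y t := hw.
  by rewrite -(chist_states hw (leqnn t)).
by rewrite [LHS]integral_cst// muleC.
Qed.

(** The exponential cost, with the actions recovered from the states: a
    function of finitely many discrete variables, almost surely equal to the
    one in [exp_cost]. *)
Definition ecost T (w : pathspace E) : \bar R :=
  (expR (\sum_(t < T) cost M (cpath zeta (states w) t)))%:E.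

Lemma ecost_ge0 T w : (0 <= ecost T w)%E.
Proof. by rewrite lee_fin expR_ge0. Qed.

Lemma ecost_local T : local_upto Y T (ecost T.+1).
Proof.
move=> w w' h; rewrite /ecost; congr (expR _)%:E; apply: eq_bigr => t _.
by congr (cost M _); apply: cpath_local => s st; apply: h; rewrite (leq_trans st)// -ltnS.
Qed.

Let mstate s : measurable_fun [set: pathspace E] (Y s).
Proof. exact: measurable_state. Qed.

Lemma ecost_measurable T : measurable_fun [set: pathspace E] (ecost T).
Proof.
apply: (local_measurable mstate (t := T)) => w w' h.
rewrite /ecost; congr (expR _)%:E; apply: eq_bigr => t _; congr (cost M _).
by apply: cpath_local => s st; apply: h; rewrite (leq_trans st)// ltnW.
Qed.

Lemma expected_costE T :
  (\int[Pr]_(w in [set w | forall t, stateaction M (w t)])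
     (expR (\sum_(t < T) cost M (w t)))%:E = \int[Pr]_w ecost T w)%E.
Proof.
have [N [mN N0 hN]] := follow_null.
set D : set (pathspace E) := [set w : nat -> nat * borelT E | _].
have mDE : D = \bigcap_t ((fun w : pathspace E => w t) @^-1` stateaction M).
  by apply/seteqP; split => w h t; [move=> _; exact: h|exact: h t I].
have mD : measurable D.
  rewrite mDE; apply: bigcapT_measurable => t; rewrite -[X in measurable X]setTI.
  by apply: measurable_coord => //; exact: stateaction_measurable.
have mcost t : measurable_fun D (fun w : pathspace E => cost M (w t)).
  have mc := measurable_funTS (measurable_coord (E := E) t) : measurable_fun D _.
  apply: (measurable_comp (stateaction_measurable M) _ (cost_measurable hA) mc).
  by move=> _ [w Dw <-]; exact: Dw.
have mS : measurable_fun D (fun w : pathspace E => (expR (\sum_(t < T) cost M (w t)))%:E).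
  apply/measurable_EFinP; apply: measurableT_comp => //.
  by apply: measurable_sum => t.
rewrite integral_mkcond; apply: ae_eq_integral => //.
- by apply/(measurable_restrict _ mD measurableT); rewrite setTI.
- exact: ecost_measurable.
exists N; split => // w /= h; apply: contrapT => nN; apply: h => _.
have wE t : w t = cpath zeta (states w) t := follow_cpath t (hN w nN).
rewrite patchE mem_set; last by move=> t; rewrite wE; exact: cpath_stateaction.
by rewrite /ecost; congr (expR _)%:E; apply: eq_bigr => t _; rewrite -wE.
Qed.

Definition expected T (G : nat -> R) := (\int[Pr]_w (ecost T w * (G (Y T w))%:E))%E.

Lemma expected1 T : expected T (fun=> 1) = (\int[Pr]_w ecost T w)%E.
Proof. by apply: eq_integral => w _; rewrite mule1. Qed.

(** The cost up to time T depends only on the states up to T, so averaging over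
    the last state first yields the twisted average. *)
Lemma expected_step T G : (forall j, 0 <= G j) ->
  expected T.+1 G = (\int[Pr]_w (ecost T w *
    twisted M G (states w T) (cact zeta (states w) T)))%E.
Proof.
move=> G0; rewrite /expected.
rewrite (one_step_integral mstate (kappa := kappa) _ law_markov (F := ecost T.+1)
   (G := fun j => (G j)%:E)); last 4 first.
- by move=> t w w' h; rewrite /kappa; congr (trans M _); exact: cpath_local.
- exact: ecost_local.
- by move=> w; exact: ecost_ge0.
- by move=> j; rewrite lee_fin.
by apply: eq_integral => w _; rewrite /ecost big_ord_recr /= expRD EFinM -muleA.
Qed.

Lemma expected_measurable T (G : nat -> \bar R) :
  measurable_fun [set: pathspace E] (fun w => ecost T w * G (Y T w))%E.
Proof.
apply: (local_measurable mstate (t := T)) => w w' h; rewrite (h T)//; congr (_ * _)%E.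
rewrite /ecost; congr (expR _)%:E; apply: eq_bigr => t _; congr (cost M _).
by apply: cpath_local => s st; apply: h; rewrite (leq_trans st)// ltnW.
Qed.

Lemma twisted_measurable T G :
  measurable_fun [set: pathspace E] (fun w => ecost T w *
    twisted M G (states w T) (cact zeta (states w) T))%E.
Proof.
apply: (local_measurable mstate (t := T)) => w w' h.
have ch s : (s <= T)%N -> cpath zeta (states w) s = cpath zeta (states w') s.
  by move=> st; apply: cpath_local => k ks; apply: h; exact: leq_trans ks st.
rewrite /ecost; congr (_ * _)%E; last first.
  have := ch T (leqnn T); rewrite /cpath => -[-> ->] //.
by congr (expR _)%:E; apply: eq_bigr => t _; rewrite ch// ltnW.
Qed.

Lemma expected0 G : (forall j, 0 <= G j) -> expected 0 G = (G i)%:E.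
Proof.
move=> G0; have [h0 _ _] := hl.
rewrite /expected; transitivity (\int[Pr]_w (fun=> (G i)%:E) w)%E; last first.
  by rewrite integral_cst// [X in (_ * X)%E]probability_setT mule1.
have m0 : measurable [set w : pathspace E | (w 0%N).1 = i].
  rewrite (_ : mkset _ = Y 0%N @^-1` [set i])//.
  by rewrite -[X in measurable X]setTI; exact: mstate.
apply: ae_eq_integral => //; first exact: (@expected_measurable 0 (EFin \o G)).
exists (~` [set w : pathspace E | (w 0%N).1 = i]); split.
- exact: measurableC.
- transitivity (1 - 1 : \bar R)%E; last by rewrite subee.
  by rewrite -[X in _ = (_ - X)%E]h0; exact: probability_setC.
move=> w /= h wi; apply: h => _.
by rewrite /ecost big_ord0 expR0 mul1e /Y wi.
Qed.

Lemma expected_ge T (a : R) G : (forall j, 0 <= G j) -> 0 <= a ->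
  (forall y t, ((a * G (y t))%:E <= twisted M G (y t) (cact zeta y t))%E) ->
  (a%:E * expected T G <= expected T.+1 G)%E.
Proof.
move=> G0 a0 h; rewrite expected_step// /expected -ge0_integralZl_EFin//; last 2 first.
- by move=> w _; rewrite mule_ge0 ?ecost_ge0 ?lee_fin.
- exact: (@expected_measurable T (EFin \o G)).
apply: ge0_le_integral => //.
- by move=> w _; rewrite !mule_ge0 ?ecost_ge0 ?lee_fin.
- apply: (eq_measurable_fun (fun w => ecost T w * ((fun j => a%:E * (G j)%:E) (Y T w)))%E).
    by move=> w _; rewrite muleCA.
  exact: (@expected_measurable T (fun j => a%:E * (G j)%:E)%E).
- exact: twisted_measurable.
by move=> w _; rewrite muleCA lee_wpmul2l ?ecost_ge0// -EFinM; exact: h.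
Qed.

Lemma expected_le T (a b : R) G : (forall j, 0 <= G j) -> 0 <= a -> 0 <= b ->
  (forall y t, (twisted M G (y t) (cact zeta y t) <= (a * G (y t) + b)%:E)%E) ->
  (expected T.+1 G <= a%:E * expected T G + b%:E * expected T (fun=> 1%R))%E.
Proof.
move=> G0 a0 b0 h; rewrite expected_step// /expected -!ge0_integralZl_EFin//; last 4 first.
- by move=> w _; rewrite mule_ge0 ?ecost_ge0 ?lee_fin.
- exact: (@expected_measurable T (fun=> 1%:E)).
- by move=> w _; rewrite mule_ge0 ?ecost_ge0 ?lee_fin.
- exact: (@expected_measurable T (EFin \o G)).
have m1 : measurable_fun [set: pathspace E] (fun w => a%:E * (ecost T w * (G (Y T w))%:E))%E.
  apply: (eq_measurable_fun (fun w => ecost T w * ((fun j => a%:E * (G j)%:E) (Y T w)))%E).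
    by move=> w _; rewrite muleCA.
  exact: (@expected_measurable T (fun j => a%:E * (G j)%:E)%E).
have m2 : measurable_fun [set: pathspace E] (fun w => b%:E * (ecost T w * 1%:E))%E.
  apply: (eq_measurable_fun (fun w => ecost T w * ((fun=> (b * 1)%:E) (Y T w)))%E).
    by move=> w _; rewrite muleCA.
  exact: (@expected_measurable T (fun=> (b * 1)%:E)).
rewrite -ge0_integralD//; last 2 first.
- by move=> w _; rewrite !mule_ge0 ?ecost_ge0 ?lee_fin.
- by move=> w _; rewrite !mule_ge0 ?ecost_ge0 ?lee_fin.
apply: ge0_le_integral => //.
- by move=> w _; rewrite mule_ge0 ?ecost_ge0 ?twisted_ge0.
- exact: twisted_measurable.
- exact: emeasurable_funD.
move=> w _; apply: (@le_trans _ _ (ecost T w * (a * G (Y T w) + b)%:E)%E).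
  by rewrite lee_wpmul2l ?ecost_ge0//; exact: h.
by rewrite /ecost -!EFinM -EFinD lee_fin mulrDr mulr1 mulrCA [b * _]mulrC.
Qed.

Lemma expected_mono T f g : (forall j, 0 <= f j) -> (forall j, f j <= g j) ->
  (expected T f <= expected T g)%E.
Proof.
move=> f0 fg; apply: ge0_le_integral => //.
- by move=> w _; rewrite mule_ge0 ?ecost_ge0 ?lee_fin.
- exact: (@expected_measurable T (EFin \o f)).
- exact: (@expected_measurable T (EFin \o g)).
by move=> w _; rewrite lee_wpmul2l ?ecost_ge0 ?lee_fin.
Qed.

Lemma expectedZ T (a : R) f : 0 <= a -> (forall j, 0 <= f j) ->
  expected T (fun j => a * f j) = (a%:E * expected T f)%E.
Proof.
move=> a0 f0; rewrite /expected -ge0_integralZl_EFin//; last 2 first.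
- by move=> w _; rewrite mule_ge0 ?ecost_ge0 ?lee_fin.
- exact: (@expected_measurable T (EFin \o f)).
by apply: eq_integral => w _; rewrite EFinM muleCA.
Qed.

Lemma expected_ge0 T f : (forall j, 0 <= f j) -> (0 <= expected T f)%E.
Proof.
by move=> f0; apply: integral_ge0 => w _; rewrite mule_ge0 ?ecost_ge0 ?lee_fin.
Qed.

End LawConsequences.

(** * Realizing a discrete process on the unit interval *)
Section NestedIntervals.
Context (R : realType) (q : seq nat -> nat -> R).
Context (q0 : forall x j, 0 <= q x j).
Context (q1 : forall x, \sum_(j < n) q x j @[n --> \oo] --> (1 : R)).
Implicit Types (x : seq nat) (om : R).

Definition cum x n := \sum_(j < n) q x j.

(** A list records the states visited so far, latest first.  The cell of a list
    is an interval of length [len]; the cells of its extensions by one state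
    cut it from left to right into pieces of relative lengths [q x j]. *)
Fixpoint len x : R := if x is j :: x' then len x' * q x' j else 1.

Fixpoint lo x : R := if x is j :: x' then lo x' + len x' * cum x' j else 0.

Definition cell x om := lo x <= om < lo x + len x.

Lemma len_ge0 x : 0 <= len x.
Proof. by elim: x => //= j x IH; rewrite mulr_ge0. Qed.

Lemma cumS x n : cum x n.+1 = cum x n + q x n.
Proof. by rewrite /cum big_ord_recr. Qed.

Lemma le_cum x m n : (m <= n)%N -> cum x m <= cum x n.
Proof.
by move=> mn; apply: (nondecreasing_seqP (cum x)).1 mn => k; rewrite cumS lerDl.
Qed.

Lemma cum_ge0 x n : 0 <= cum x n.
Proof. by apply: sumr_ge0. Qed.

Lemma cum_le1 x n : cum x n <= 1.
Proof.
apply: (ler_cvg_to (cvg_cst (cum x n)) (q1 x)).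
by exists n => // m /= nm; exact: le_cum.
Qed.

Lemma cell_right x j : lo (j :: x) + len (j :: x) = lo x + len x * cum x j.+1.
Proof. by rewrite /= cumS mulrDr addrA. Qed.

(** The index of the piece of the cell of x that contains om. *)
Definition next x om : nat :=
  if pselect (exists n, om < lo x + len x * cum x n.+1) is left h
  then ex_minn h else 0.

(** The right ends of the pieces increase to the right end of the cell, the
    weights [q x j] having sum 1, so om lies to the left of one of them. *)
Lemma cell_next x om : cell x om -> cell (next x om :: x) om.
Proof.
move=> /andP[h1 h2]; rewrite /cell cell_right /next.
case: pselect => [h|]; last first.
  move=> nh; exfalso; apply: nh.
  have : lo x + len x * cum x n @[n --> \oo] --> lo x + len x * 1.
    by apply: cvgD; [exact: cvg_cst|apply: cvgMr; exact: q1].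
  rewrite mulr1 => /cvgr_gt /(_ _ h2) [N _ hN]; exists N.
  by apply: hN => /=.
case: ex_minnP => j hj jmin; rewrite hj andbT /=.
case: j jmin {hj} => [|j] jmin; first by rewrite /cum big_ord0 mulr0 addr0.
by rewrite leNgt; apply/negP => /jmin; rewrite ltnn.
Qed.

Lemma cell_cons x j om : cell (j :: x) om -> cell x om /\ next x om = j.
Proof.
rewrite /cell cell_right /= => /andP[h1 h2]; have l0 := len_ge0 x; split.
  apply/andP; split; first by apply: le_trans h1; rewrite lerDl mulr_ge0 ?cum_ge0.
  by apply: lt_le_trans h2 _; rewrite lerD2l ler_piMr ?cum_le1.
rewrite /next; case: pselect => [h|]; last by move=> nh; exfalso; apply: nh; exists j.
case: ex_minnP => k hk kmin; apply/eqP; rewrite eqn_leq (kmin _ h2) /= leqNgt.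
apply/negP => kj; move: hk; apply/negP; rewrite -leNgt (le_trans _ h1)// lerD2l.
by rewrite ler_wpM2l// le_cum.
Qed.

Fixpoint prefix om t : seq nat :=
  if t is s.+1 then next (prefix om s) om :: prefix om s else [::].

Lemma cell_prefix om t : 0 <= om < 1 -> cell (prefix om t) om.
Proof.
by move=> om01; elim: t => [|t IH] /=; [rewrite /cell /= add0r|exact: cell_next].
Qed.

Lemma prefixE om x : 0 <= om < 1 -> (prefix om (size x) == x) = cell x om.
Proof.
move=> om01; apply/eqP/idP => [<-|]; first exact: cell_prefix.
by elim: x => //= j x IH /cell_cons[/IH -> ->].
Qed.

Lemma cell_subset x om : cell x om -> 0 <= om < 1.
Proof.
elim: x => [|j x IH]; first by rewrite /cell /= add0r.
by move=> /cell_cons[/IH].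
Qed.

(** Outside [0, 1[, a null set, the process is given the value it has at 0,
    which keeps it measurable on the whole line. *)
Definition clip om : R := if 0 <= om < 1 then om else 0.

Let T := measurableTypeR R.
Let P : probability T R := uniform_prob (@ltr01 R).

Lemma uniform_prob01 (A : set T) : measurable A -> A `<=` `[0, 1]%classic ->
  P A = lebesgue_measure A.
Proof.
move=> mA A01.
have -> : P A = (\int[P]_x (\1_A x)%:E)%E by rewrite integral_indic// setIT.
rewrite integral_uniform//; last first.
  by apply/measurable_EFinP.
by rewrite subr0 invr1 mul1e integral_indic// setIidl.
Qed.

Lemma cell_itv x : [set om : T | cell x om] = `[lo x, lo x + len x[%classic.
Proof. by apply/seteqP; split => om /=; rewrite in_itv. Qed.

Lemma prob_cell x : P [set om : T | cell x om] = (len x)%:E.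
Proof.
rewrite uniform_prob01; last 2 first.
- by rewrite cell_itv; exact: measurable_itv.
- by move=> om /cell_subset /andP[h1 h2]; rewrite /= in_itv /= h1 ltW.
rewrite cell_itv lebesgue_measure_itv /= lte_fin.
case: ltP => [|]; first by rewrite -EFinD addrAC subrr add0r.
by rewrite gerDl => l0; congr EFin; apply/eqP; rewrite eq_le l0 len_ge0.
Qed.

Definition state t (om : T) : nat := head 0 (prefix (clip om) t.+1).

Lemma prefix_state om t : prefix (clip om) t = rev (mkseq (state^~ om) t).
Proof. by elim: t => // t IH; rewrite mkseqS rev_rcons -IH. Qed.

Let I01 : set T := `[0, 1[%classic.

Let mI01 : measurable I01. Proof. exact: measurable_itv. Qed.

Lemma clip_id om : I01 om -> clip om = om.
Proof. by rewrite /I01 /= in_itv /= /clip => ->. Qed.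

Lemma clip_out om : ~ I01 om -> clip om = 0.
Proof. by rewrite /I01 /= in_itv /= /clip => /negP/negbTE ->. Qed.

Lemma prefix_set x : [set om : T | prefix (clip om) (size x) = x] =
  [set om | cell x om] `|`
  (~` I01 `&` [set om | prefix 0 (size x) = x]).
Proof.
apply/seteqP; split=> om /=.
  have [i01|n01] := pselect (I01 om).
    by rewrite clip_id// => /eqP; rewrite prefixE//; left.
  by rewrite clip_out//; right.
move=> [h|[n01 h]]; last by rewrite clip_out.
have om01 := cell_subset h.
by rewrite clip_id; [apply/eqP; rewrite prefixE|rewrite /I01 /= in_itv].
Qed.

Let measurable_cond (Q : Prop) : measurable [set om : T | Q].
Proof.
have [q'|q'] := pselect Q.
  by rewrite (_ : mkset _ = setT)//; apply/seteqP; split.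
by rewrite (_ : mkset _ = set0)//; apply/seteqP; split.
Qed.

Let measurable_cell x : measurable [set om : T | cell x om].
Proof. by rewrite cell_itv; exact: measurable_itv. Qed.

Lemma measurable_prefix x : measurable [set om : T | prefix (clip om) (size x) = x].
Proof.
rewrite prefix_set; apply: measurableU; first exact: measurable_cell.
by apply: measurableI; [exact: measurableC|exact: measurable_cond].
Qed.

Lemma prob_prefix x : P [set om : T | prefix (clip om) (size x) = x] = (len x)%:E.
Proof.
rewrite -prob_cell; apply: (eq_measure_null (N := ~` I01)).
- exact: measurableC.
- transitivity (1 - 1 : \bar R)%E; last by rewrite subee.
  have P01 : P I01 = 1%E.
    rewrite -[RHS](prob_cell [::]) /=; congr (P _).
    by apply/seteqP; split => om; rewrite /I01 /cell /= in_itv /= add0r.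
  rewrite -[X in _ = (_ - X)%E]P01; exact: probability_setC.
- exact: measurable_prefix.
- exact: measurable_cell.
- by rewrite prefix_set => om; left.
- by rewrite prefix_set => om [|[]]; [left|right].
Qed.

Lemma size_prefix om t : size (prefix om t) = t.
Proof. by elim: t => //= t ->. Qed.

Lemma measurable_fun_state t : measurable_fun [set: T] (state t).
Proof.
move=> _ B mB; rewrite setTI.
pose F x := [set om : T | prefix (clip om) (size x) = x] `&`
   [set om | size x = t.+1 /\ B (head 0 x)].
rewrite (_ : _ @^-1` _ = \bigcup_x F x).
  apply: countable_bigcupT_measurable => [|x]; first exact: countableP.
  by apply: measurableI; [exact: measurable_prefix|exact: measurable_cond].
apply/seteqP; split => [om Bom|om [x _ [/= px [sx Bx]]]].
  by exists (prefix (clip om) t.+1) => //; split; rewrite /= ?size_prefix.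
by rewrite /= /state -sx px.
Qed.

Lemma agree_prefix (y : nat -> nat) t : agree state y t =
  [set om | prefix (clip om) (size (rev (mkseq y t.+1))) = rev (mkseq y t.+1)].
Proof.
rewrite size_rev size_mkseq; apply/seteqP; split => om /=.
  move=> h; rewrite -[LHS]/(prefix (clip om) t.+1) prefix_state; congr rev.
  by apply/eq_in_map => s; rewrite mem_iota /= add0n; exact: h.
move=> h s st; have : prefix (clip om) t.+1 = rev (mkseq y t.+1) := h.
rewrite prefix_state => /(can_inj revK) /(congr1 (nth 0 ^~ s)).
by rewrite !nth_mkseq.
Qed.

Lemma prob_agree y t : P (agree state y t) = (len (rev (mkseq y t.+1)))%:E.
Proof. by rewrite agree_prefix prob_prefix. Qed.

Lemma state_markov y t j : P (agree state y t `&` [set om | state t.+1 om = j]) =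
  (P (agree state y t) * (q (rev (mkseq y t.+1)) j)%:E)%E.
Proof.
pose y' s := if (s <= t)%N then y s else j.
rewrite (_ : _ `&` _ = agree state y' t.+1).
  rewrite !prob_agree mkseqS rev_rcons /= -EFinM /y' ltnn.
  have -> // : mkseq y' t.+1 = mkseq y t.+1.
  by apply/eq_in_map => s; rewrite mem_iota /= add0n ltnS => st; rewrite /y' st.
apply/seteqP; split => om.
  move=> [h /= hj] s; rewrite leq_eqVlt => /orP[/eqP ->|st].
    by rewrite /y' ltnn.
  by rewrite /y' -ltnS st; exact: h.
move=> h; split; last by have := h t.+1 (leqnn _); rewrite /y' ltnn.
by move=> s st; have := h s (leqW st); rewrite /y' st.
Qed.

End NestedIntervals.

(** * Existence of the law *)
Section LawExistence.
Context (R : realType) (E : completeMetricType R) (M : dtcmp E).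
Context (zeta : control E) (az : admissible M zeta) (i : nat).

Lemma discrete_probabilityE (mu : probability nat R) (A : set nat) :
  mu A = (\sum_(0 <= j <oo) (\1_A j)%:E * mu [set j])%E.
Proof.
have -> : mu A = mu (\bigcup_j (A `&` [set j])).
  by congr (mu _); apply/seteqP; split=> [j Aj|j [k _ []]] //; exists j.
rewrite measure_semi_bigcup//; last first.
  apply/trivIsetP => k l _ _ /eqP kl; apply/seteqP; split=> // x.
  by move=> [[_ /= xk] [_ /= xl]]; apply: kl; rewrite -xk.
apply: eq_eseriesr => j _; rewrite indicE.
have [Aj|nAj] := boolP (j \in A).
  rewrite mul1e; congr (mu _); apply/seteqP; split=> [k []//|k ->].
  by split => //; rewrite inE in Aj.
rewrite mul0e (_ : A `&` _ = set0) ?measure0//.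
apply/seteqP; split => // k [Ak jk]; move: nAj; rewrite -jk.
by rewrite mem_set.
Qed.

(** The initial state is drawn by the same mechanism, from the empty list.
    The lists are in reverse chronological order, hence the reversal; at the
    list of the states up to time t the current time is t. *)
Definition transition (x : seq nat) (j : nat) : R :=
  if x is [::] then (j == i)%:R
  else fine (trans M (cpath zeta (nth 0 (rev x)) (size x).-1) [set j]).

Lemma transition_ge0 x j : 0 <= transition x j.
Proof. by case: x => [|k x] /=; [|apply: fine_ge0]. Qed.

Lemma transition_sum x : \sum_(j < n) transition x j @[n --> \oo] --> (1 : R).
Proof.
case: x => [|k x].
  apply: cvg_near_cst; exists i.+1 => // n /= jn.
  rewrite (bigD1 (Ordinal jn)) //= eqxx big1 ?addr0// => j.
  by rewrite -val_eqE /= => /negbTE ->.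
set kap := trans M (cpath zeta (nth 0 (rev (k :: x))) (size (k :: x)).-1).
have tE j : (transition (k :: x) j)%:E = kap [set j].
  by rewrite /transition fineK// fin_num_measure.
have cE : (\sum_(0 <= j < n) kap [set j])%E @[n --> \oo] --> (1%:E : \bar R).
  have := @is_cvg_nneseries R (fun j => kap [set j]) xpredT 0 (fun _ _ _ => measure_ge0 _ _).
  rewrite (_ : limn _ = 1%:E) => // .
  have := discrete_probabilityE kap setT; rewrite probability_setT => ->.
  by apply: eq_eseriesr => j _; rewrite indicT mul1e.
rewrite (_ : (fun n => _) = fine \o (fun n => \sum_(0 <= j < n) kap [set j])%E).
  exact: fine_cvg cE.
apply/funext => n /=; rewrite big_mkord.
by under [in RHS]eq_bigr do rewrite -tE; rewrite sumEFin.
Qed.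

Let Y := state transition.
Let P : probability (measurableTypeR R) R := uniform_prob (@ltr01 R).
Let mY t : measurable_fun [set: measurableTypeR R] (Y t).
Proof. exact: (measurable_fun_state transition_ge0 transition_sum). Qed.

Let kappa y t := trans M (cpath zeta y t).

Let kappa_local t : local_upto Y t (fun om => kappa (Y^~ om) t).
Proof. by move=> w w' h; rewrite /kappa; congr (trans M _); exact: cpath_local. Qed.

Let markov y t j : P (agree Y y t `&` [set om | Y t.+1 om = j]) =
  (P (agree Y y t) * kappa y t [set j])%E.
Proof.
rewrite (state_markov transition_ge0 transition_sum); congr (_ * _)%E.
rewrite /transition mkseqS rev_rcons /= size_rev size_mkseq rev_cons revK -mkseqS.
rewrite /kappa fineK ?fin_num_measure//; congr (trans M _ _); apply: cpath_local => s st.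
by rewrite nth_mkseq.
Qed.

Definition run (om : measurableTypeR R) : pathspace E := cpath zeta (Y^~ om).

Lemma run_measurable : measurable_fun [set: measurableTypeR R] run.
Proof.
apply: (@measurability _ _ (measurableTypeR R) (g_sigma_algebraType (@cylinders R E))
  setT run (@cylinders R E)) => //.
move=> _ [_ [t [A mA ->]] <-].
have ml : local_upto Y t (fun om => cpath zeta (Y^~ om) t).
  by move=> w w' h; exact: cpath_local.
exact: (local_measurable mY ml measurableT mA).
Qed.

(** The law of [run], the path with the states of the interval construction.
    Every value of [run] follows the control, but the set of all paths that do
    so need not be measurable; as finitely many states take countably many
    values, it contains a countable intersection of countable unions of
    events fixing one history, and this has full measure. *)
Lemma law_exists : exists Pr, is_law M i zeta Pr.
Proof.
pose X : {mfun measurableTypeR R >-> pathspace E} := mfun_Sub (mem_set run_measurable).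
have hist_run t om : hist_of t (run om) = chist zeta (Y^~ om) t by exact: hist_of_cpath.
exists (distribution P X); split.
- rewrite -[LHS]/(P (run @^-1` _)) (_ : _ @^-1` _ = agree Y (fun=> i) 0).
    rewrite (prob_agree transition_ge0 transition_sum) /= /mkseq /= mul1r.
    by rewrite /transition eqxx.
  by apply/seteqP; split => om /=; [move=> h s; rewrite leqn0 => /eqP -> |apply].
(* G asks that at each time the history and the current state and action are
   those of some finite list of states. *)
- pose yx (x : seq nat) := nth 0 x.
  pose G := \bigcap_t \bigcup_(x in [set: seq nat])
    ((@hist_of R E t @^-1` [set chist zeta (yx x) t]) `&`
     ((fun w : pathspace E => w t) @^-1` [set cpath zeta (yx x) t])).
  have mG : measurable G.
    apply: bigcapT_measurable => t.
    apply: countable_bigcupT_measurable => [|x]; first exact: countableP.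
    apply: measurableI; rewrite -[X in measurable X]setTI.
      by apply: measurable_hist => //; exact: history_set1_measurable.
    by apply: measurable_coord => //; exact: stateaction_set1_measurable.
  exists (~` G); split; first exact: measurableC.
    rewrite -[LHS]/(P (run @^-1` _)) (_ : _ @^-1` _ = set0) ?measure0//.
    apply/seteqP; split => // om; apply => t _.
    have h s : (s <= t)%N -> Y s om = yx (mkseq (Y^~ om) t.+1) s.
      by move=> st; rewrite /yx nth_mkseq.
    exists (mkseq (Y^~ om) t.+1) => //; split => /=.
      by rewrite hist_run; exact: chist_local.
    exact: cpath_local.
  move=> w /= nw Gw; apply: nw => t.
  by have [x _ [/= -> ->]] := Gw t I.
move=> t B A mB BH.
pose D := [set om | B (chist zeta (Y^~ om) t)].
have lD : local_upto Y t (fun om => D om).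
  by move=> w w' h; rewrite /D /= (chist_local zeta (y' := Y^~ w')).
have mD : measurable D.
  rewrite (_ : D = (fun om => chist zeta (Y^~ om) t) @^-1` B)//.
  rewrite -[X in measurable X]setTI.
  have lc : local_upto Y t (fun om => chist zeta (Y^~ om) t).
    by move=> w w' h; exact: chist_local.
  exact: (local_measurable mY lc measurableT mB).
have mA : measurable [set om | A (Y t.+1 om)].
  rewrite (_ : mkset _ = Y t.+1 @^-1` A)//.
  by rewrite -[X in measurable X]setTI; exact: mY.
have mDB : measurable [set w : pathspace E | B (hist_of t w)].
  rewrite (_ : mkset _ = @hist_of R E t @^-1` B)//.
  by rewrite -[X in measurable X]setTI; exact: measurable_hist.
transitivity (\int[P]_om ((\1_D om)%:E * (\1_A (Y t.+1 om))%:E))%E.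
  rewrite -[LHS]/(P (run @^-1` _)) (_ : _ @^-1` _ = D `&` [set om | A (Y t.+1 om)]); last first.
    by apply/seteqP; split => om /=; rewrite hist_run.
  transitivity (\int[P]_om (\1_(D `&` [set om | A (Y t.+1 om)]) om)%:E)%E.
    by rewrite integral_indic ?setIT//; exact: measurableI.
  apply: eq_integral => om _; rewrite -EFinM; congr EFin.
  by rewrite indicI.
rewrite (one_step_integral mY kappa_local markov (F := fun om => (\1_D om)%:E)
  (G := fun j => (\1_A j)%:E)); last 3 first.
- move=> w w' h; rewrite !indicE; congr ((nat_of_bool _)%:R)%:E.
  by apply/idP/idP; rewrite !inE (lD _ _ h).
- by move=> w; rewrite lee_fin.
- by move=> w; rewrite lee_fin.
rewrite ge0_integral_pushforward//.
  rewrite [RHS]integral_mkcond; apply: eq_integral => om _.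
  rewrite -discrete_probabilityE patchE indicE.
  have -> : (om \in X @^-1` [set w | B (hist_of t w)]) = (om \in D).
    apply/idP/idP; rewrite !inE /=; first by rewrite hist_run.
    by rewrite /D /= -hist_run.
  case: (om \in D); last by rewrite mul0e.
  by rewrite mul1e /kappa /cpath /cact -hist_run.
(* The control is measurable on admissible histories only; z extends it. *)
pose z : t.-tuple (nat * borelT E) * nat -> borelT E :=
  (@zeta t : t.-tuple (nat * borelT E) * nat -> borelT E) \_ (@histories R E M t).
have mz : measurable_fun setT z.
  apply/(measurable_restrict _ (@histories_measurable _ _ M t) measurableT).
  by rewrite setTI; exact: (az t).1.
have mp : measurable_fun [set w : pathspace E | B (hist_of t w)]
    (fun w : pathspace E => ((w t).1, z (hist_of t w))).
  apply: measurable_funTS; apply: measurable_fun_pair; first exact: measurable_state.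
  exact: (measurableT_comp mz (@measurable_hist R E t)).
have zE (w : pathspace E) : B (hist_of t w) -> z (hist_of t w) = zeta (hist_of t w).
  by move=> Bw; rewrite /z patchE mem_set//; exact: BH.
apply: (eq_measurable_fun ((fun x => trans M x A) \o
    (fun w : pathspace E => ((w t).1, z (hist_of t w))))).
  by move=> w; rewrite inE => Bw; rewrite /= zE.
have img : [set ((w t).1, z (hist_of t w)) | w in [set w : pathspace E | B (hist_of t w)]]
    `<=` stateaction M.
  move=> _ [w Bw <-]; rewrite /stateaction /= zE//.
  have [_ h] := az t; exact: (h (hist_of t w) (BH _ Bw)).
have mt : measurable_fun (stateaction M) (fun x => trans M x A) := @trans_measurable _ _ M A.
exact: (measurable_comp (stateaction_measurable M) img mt mp).
Qed.

Lemma law_is_law : is_law M i zeta (law M i zeta).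
Proof. exact: getPex law_exists. Qed.

End LawExistence.

(** * The risk-sensitive cost and the optimal value *)
Section RiskCost.
Context (R : realType).

Lemma limn_esup_ge (u : nat -> \bar R) (l k : R) :
  (forall T, ((l + k / T.+1%:R)%:E <= u T.+1)%E) -> (l%:E <= limn_esup u)%E.
Proof.
move=> h; apply/ereal_infP => _ [B [N _ hB] <-].
apply/lee_addgt0Pr => e e0.
have [n hn] : exists n : nat, `|k| / e < n%:R.
  by exists (Num.bound (`|k| / e)); exact: archi_boundP (divr_ge0 _ (ltW e0)).
pose T := maxn N n.
have Tn : `|k| / e < T.+1%:R.
  by apply: lt_le_trans hn _; rewrite ler_nat leqW// leq_maxr.
have uB : (u T.+1 <= ereal_sup (u @` B))%E.
  by apply: ereal_sup_ubound; exists T.+1 => //; apply: hB; rewrite /= leqW// leq_maxl.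
apply: (@le_trans _ _ (u T.+1 + e%:E)%E); last by rewrite leeD2r.
apply: (@le_trans _ _ ((l + k / T.+1%:R)%:E + e%:E)%E); last by rewrite leeD2r.
rewrite -EFinD lee_fin -addrA lerDl.
have T0 : (0 : R) < T.+1%:R by rewrite ltr0n.
have : `|k / T.+1%:R| <= e.
  rewrite normrM normfV (gtr0_norm T0) ler_pdivrMr// mulrC -ler_pdivrMr//.
  exact: ltW.
by rewrite ler_norml => /andP[+ _]; rewrite -subr_ge0 opprK.
Qed.

Lemma limn_esup_le (u : nat -> \bar R) (l k : R) :
  (forall T, (u T.+1 <= (l + k / T.+1%:R)%:E)%E) -> (limn_esup u <= l%:E)%E.
Proof.
move=> h; apply/lee_addgt0Pr => e e0.
have [n hn] : exists n : nat, `|k| / e < n%:R.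
  by exists (Num.bound (`|k| / e)); exact: archi_boundP (divr_ge0 _ (ltW e0)).
apply: (@le_trans _ _ (ereal_sup (u @` [set T | (n < T)%N]))).
  by apply: ereal_inf_lbound; exists [set T | (n < T)%N] => //; exists n.+1.
apply: ge_ereal_sup => _ [[//|T] nT <-].
apply: le_trans (h T) _; rewrite -EFinD lee_fin lerD2l.
have T0 : (0 : R) < T.+1%:R by rewrite ltr0n.
have Tn : `|k| / e < T.+1%:R by apply: lt_le_trans hn _; rewrite ler_nat ltnW.
have : `|k / T.+1%:R| <= e.
  rewrite normrM normfV (gtr0_norm T0) ler_pdivrMr// mulrC -ler_pdivrMr//.
  exact: ltW.
by rewrite ler_norml => /andP[_ ].
Qed.

Lemma lne_ge (x : R) (b : \bar R) : 0 < x -> (x%:E <= b)%E -> ((ln x)%:E <= lne b)%E.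
Proof.
move=> x0; case: b => [b| |]//=; last by move=> _; rewrite leey.
rewrite lee_fin => xb; have b0 := lt_le_trans x0 xb.
by rewrite [b <= 0]leNgt b0 /= lee_fin ler_ln.
Qed.

Lemma lne_le (x : R) (b : \bar R) : 0 < x -> (b <= x%:E)%E -> (lne b <= (ln x)%:E)%E.
Proof.
move=> x0; case: b => [b| |] /=; [rewrite lee_fin => xb|by rewrite leye_eq|by move=> _; rewrite leNye].
have [b0|b0] := leP b 0; first by rewrite leNye.
by rewrite lee_fin ler_ln// posrE.
Qed.

Context (E : completeMetricType R) (M : dtcmp E).

Lemma risk_cost_ge i zeta (l k : R) : 0 < k ->
  (forall T, ((k * expR l ^+ T)%:E <= exp_cost M i zeta T)%E) ->
  (l%:E <= risk_cost M i zeta)%E.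
Proof.
move=> k0 h; apply: (@limn_esup_ge _ l (ln k)) => T.
have T0 : (0 : R) < T.+1%:R by rewrite ltr0n.
have x0 : 0 < k * expR l ^+ T.+1 by rewrite mulr_gt0// exprn_gt0 ?expR_gt0.
apply: (@le_trans _ _ ((T.+1%:R^-1)%:E * (ln (k * expR l ^+ T.+1))%:E)%E).
  rewrite -EFinM lee_fin lnM ?posrE ?exprn_gt0 ?expR_gt0// -expRM_natl expRK.
  by rewrite mulrDr mulrA mulVf ?gt_eqF// mul1r addrC mulrC.
by rewrite lee_wpmul2l ?lee_fin ?invr_ge0// lne_ge.
Qed.

Lemma risk_cost_le i zeta (l k : R) : 0 < k ->
  (forall T, (exp_cost M i zeta T <= (k * expR l ^+ T)%:E)%E) ->
  (risk_cost M i zeta <= l%:E)%E.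
Proof.
move=> k0 h; apply: (@limn_esup_le _ l (ln k)) => T.
have T0 : (0 : R) < T.+1%:R by rewrite ltr0n.
have x0 : 0 < k * expR l ^+ T.+1 by rewrite mulr_gt0// exprn_gt0 ?expR_gt0.
apply: (@le_trans _ _ ((T.+1%:R^-1)%:E * (ln (k * expR l ^+ T.+1))%:E)%E).
  by rewrite lee_wpmul2l ?lee_fin ?invr_ge0// lne_le.
rewrite -EFinM lee_fin lnM ?posrE ?exprn_gt0 ?expR_gt0// -expRM_natl expRK.
by rewrite mulrDr mulrA mulVf ?gt_eqF// mul1r addrC mulrC.
Qed.

Context (hA : condA M).
Context (W : nat -> R) (n0 : nat) (r C : R) (lyap : risk_lyapunov M W n0 r C).

Let W0 j : 0 < W j. Proof. exact: lt_le_trans (lyap_ge1 lyap j). Qed.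
Let W0' j : 0 <= W j. Proof. exact: ltW. Qed.

(** The subsolution property makes E[e^{sum c} psi(X_T)] grow at least like
    e^{l T}, but psi is unbounded.  It is replaced by W and then by 1: the
    drift gives a(T+1) <= r a(T) + C b(T) for a(T) = E[e^{sum c} W(X_T)] and
    b(T) = E[e^{sum c}], and b is nondecreasing because the cost is
    nonnegative, so that a is at most a constant multiple of b. *)
Lemma risk_cost_lower_bound (l K : R) psi i zeta : admissible M zeta ->
  (forall j, 0 < psi j) -> (forall j, psi j <= K * W j) ->
  (forall i u, adm M i u -> ((expR l * psi i)%:E <= twisted M psi i u)%E) ->
  (l%:E <= risk_cost M i zeta)%E.
Proof.
move=> az psi0 psiK psub.
have hl := law_is_law az i; set Pr := law M i zeta in hl.
have /andP[r0 r1] := lyap_r lyap; have C0 := lyap_C lyap.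
have psi0' j : 0 <= psi j by apply/ltW.
have K0 : 0 < K by rewrite -(pmulr_lgt0 K (W0 0)); exact: lt_le_trans (psi0 0%N) (psiK 0%N).
pose a T := expected M zeta Pr T W; pose b T := expected M zeta Pr T (fun=> 1).
have bE T : exp_cost M i zeta T = b T.
  by rewrite /exp_cost (expected_costE hA az hl) /b expected1.
have path_adm y t : adm M (y t) (cact zeta y t) := cpath_stateaction az y t.
have b0 T : (0 <= b T)%E by apply: expected_ge0.
have bS T : (b T <= b T.+1)%E.
  rewrite -[leLHS]mul1e; apply: (expected_ge az hl) => // y t.
  by rewrite mul1r twisted_cst mulr1 lee_fin -expR0 ler_expR cost_ge0.
pose D := W i + C / (1 - r).
have D0 : 0 < D by rewrite addr_gt0// divr_gt0// subr_gt0.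
have aD T : (a T <= D%:E * b T)%E.
  elim: T => [|T IH].
    rewrite /a /b !(expected0 hl)// mule1 lee_fin lerDl divr_ge0 ?(ltW C0)//.
    by rewrite subr_ge0 ltW.
  have h : (a T.+1 <= r%:E * a T + C%:E * b T)%E.
    apply: (expected_le az hl) => //; [exact: ltW|exact: ltW|].
    move=> y t; have [ni|ni] := leqP n0 (y t).
      apply: le_trans (lyap_out lyap (path_adm y t) ni) _.
      by rewrite lee_fin lerDl ltW.
    apply: le_trans (lyap_in lyap (path_adm y t) ni) _.
    by rewrite lee_fin lerDr mulr_ge0// ltW.
  apply: (le_trans h).
  apply: (@le_trans _ _ (r%:E * (D%:E * b T) + C%:E * b T)%E).
    by rewrite leeD2r// lee_wpmul2l// lee_fin ltW.
  rewrite muleA -ge0_muleDl; last 2 first.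
  - by rewrite -EFinM lee_fin mulr_ge0 ?ltW.
  - by rewrite lee_fin ltW.
  apply: (@le_trans _ _ (D%:E * b T)%E); last by rewrite lee_wpmul2l// lee_fin ltW.
  rewrite lee_wpmul2r// -EFinM -EFinD lee_fin /D.
  have C1 : C = (1 - r) * (C / (1 - r)).
    by rewrite mulrCA mulfV ?mulr1// gt_eqF// subr_gt0.
  rewrite {2}C1 mulrDr mulrBl mul1r addrA [r * _ + _]addrC.
  have : r * W i <= W i by rewrite ler_piMl// ltW.
  by lra.
have apsi T : (((expR l) ^+ T * psi i)%:E <= expected M zeta Pr T psi)%E.
  elim: T => [|T IH]; first by rewrite (expected0 hl)// expr0 mul1r.
  apply: (@le_trans _ _ ((expR l)%:E * expected M zeta Pr T psi)%E).
    by rewrite exprS -mulrA EFinM lee_wpmul2l// lee_fin expR_ge0.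
  apply: (expected_ge az hl) => //.
  by move=> y t; exact: psub.
apply: (@risk_cost_ge _ _ _ (psi i / (K * D))) => [|T].
  by rewrite divr_gt0// mulr_gt0.
rewrite bE.
have KD0 : 0 < K * D by rewrite mulr_gt0.
have h : (((expR l) ^+ T * psi i)%:E <= (K * D)%:E * b T)%E.
  apply: le_trans (apsi T) _.
  apply: (le_trans (expected_mono M zeta Pr T psi0' psiK)).
  rewrite (expectedZ M zeta Pr)//; last exact: ltW.
  by rewrite EFinM -muleA; apply: lee_wpmul2l; [rewrite lee_fin ltW|exact: aD].
move: h; case: (b T) (b0 T) => [x| |]// _; last by rewrite leey.
by rewrite -EFinM !lee_fin => h; rewrite mulrAC ler_pdivrMr// [psi i * _]mulrC [x * _]mulrC.
Qed.

Definition markov_control (w : nat -> E) : control E := fun t h => w h.2.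

Lemma markov_control_admissible w : stationary M w -> admissible M (markov_control w).
Proof.
move=> sw t; split => [|h _]; last exact: sw.
apply: measurable_funTS.
exact: (measurableT_comp (f := (w : nat -> borelT E)) _ measurable_snd).
Qed.

(** The supersolution psi may approach 0 at infinity, so it gives no bound on
    E[e^{sum c}] by itself; psi + d W does, at the price of an arbitrarily
    small increase of the eigenvalue. *)
Lemma risk_cost_upper_bound (l : R) psi i w : stationary M w ->
  0 <= l -> (forall j, 0 < psi j) -> supersolution M w l psi ->
  (risk_cost M i (markov_control w) <= l%:E)%E.
Proof.
move=> sw l0 psi0 psup; apply/lee_addgt0Pr => e e0.
have az := markov_control_admissible sw.
have hl := law_is_law az i; set zeta := markov_control w in az hl *.
set Pr := law M i zeta in hl.
have /andP[r0 r1] := lyap_r lyap.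
have q1 : expR l < expR (l + e) by rewrite ltr_expR ltrDl.
have q2 : r <= expR (l + e).
  by rewrite (le_trans (ltW r1))// -expR0 ler_expR addr_ge0// ltW.
have [d d0 hd] := add_lyapunov sw lyap (expR_gt0 _) q1 q2 psi0 psup.
set f := (fun j => psi j + d * W j) in hd.
have f0 j : 0 <= f j by rewrite addr_ge0 ?mulr_ge0// ltW.
have fd j : d <= f j.
  rewrite (@le_trans _ _ (d * W j))//; last by rewrite lerDr ltW.
  by rewrite ler_peMr ?(ltW d0)// (lyap_ge1 lyap).
have fi0 : 0 < f i by exact: lt_le_trans (fd i).
have ef T : (expected M zeta Pr T f <= ((expR (l + e)) ^+ T * f i)%:E)%E.
  elim: T => [|T IH]; first by rewrite (expected0 hl)// expr0 mul1r.
  have := @expected_le _ _ _ _ az _ _ hl T (expR (l + e)) 0 f f0 (expR_ge0 _) (lexx _).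
  rewrite mul0e adde0 => h; apply: le_trans (h _) _.
    move=> y t; rewrite addr0 (_ : cact zeta y t = w (y t)); first exact: hd.
    by rewrite /cact /zeta /markov_control chist2.
  by rewrite exprS -mulrA EFinM lee_wpmul2l// lee_fin expR_ge0.
rewrite -EFinD; apply: (@risk_cost_le _ _ _ (f i / d)) => [|T].
  by rewrite divr_gt0.
rewrite /exp_cost (expected_costE hA az hl) -expected1.
have h : (d%:E * expected M zeta Pr T (fun=> 1%R) <= ((expR (l + e)) ^+ T * f i)%:E)%E.
  rewrite -(expectedZ M zeta Pr) ?(ltW d0)//; apply: le_trans (ef T).
  by apply: expected_mono => j; rewrite mulr1 ?(ltW d0)// fd.
rewrite (_ : f i / d * _ = d^-1 * ((expR (l + e)) ^+ T * f i)); last by ring.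
rewrite EFinM -[leLHS]mul1e -[X in (X * _)%E](_ : (d^-1)%:E * d%:E = _)%E; last first.
  by rewrite -EFinM mulVf// gt_eqF.
by rewrite -muleA lee_wpmul2l// lee_fin invr_ge0 ltW.
Qed.

End RiskCost.

(** The upper bound uses a stationary selection of minimizers, the lower bound
    the inequality for all actions. *)
Lemma lambda_star_hjb (R : realType) (E : completeMetricType R) (M : dtcmp E)
    (i0 : nat) (W : nat -> R) (n0 : nat) (r C l K : R) (psi : nat -> R) :
  condA M -> risk_lyapunov M W n0 r C -> 0 <= l -> hjb M i0 l psi ->
  (forall j, psi j <= K * W j) -> lambda_star M = l%:E.
Proof.
move=> hA lyap l0 [psi0 _ psim] psiK; apply/eqP; rewrite eq_le; apply/andP; split.
  have /choice[w hw] i : exists u, adm M i u /\ twisted M psi i u = (expR l * psi i)%:E.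
    by have [[u iu uE] _] := psim i; exists u.
  have sw : stationary M w by move=> i; have [] := hw i.
  have sup : supersolution M w l psi by move=> i; have [_ ->] := hw i.
  apply: le_trans (risk_cost_upper_bound hA lyap i0 sw l0 psi0 sup).
  apply: (@le_trans _ _ (ereal_inf [set risk_cost M i0 zeta | zeta in admissible M])).
    by apply: ereal_inf_lbound; exists i0.
  apply: ereal_inf_lbound; exists (markov_control w) => //.
  exact: markov_control_admissible.
apply/ereal_infP => _ [i _ <-]; apply/ereal_infP => _ [zeta az <-].
apply: (risk_cost_lower_bound hA lyap i az psi0 psiK) => j u ju.
by have [_] := psim j; apply; exists u.
Qed.

Theorem theorem4p1 (R : realType) (E : completeMetricType R)
    (hE : separable_space E) (M : dtcmp E) (i0 : nat)
    (hA : condA M) (hB : condB M i0) (hL : condL M)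
    (v : nat -> nat -> E) (lam : nat -> R) (V : nat -> nat -> R)
    (hPI : policy_iteration M i0 v lam V) :
  ((forall k, lam k.+1 <= lam k) /\
   ((lam k)%:E @[k --> \oo] --> lambda_star M)) /\
  (exists psi : nat -> R,
     [/\ hjb_solution M i0 psi,
         (forall phi : nat -> R, hjb_solution M i0 phi -> phi = psi) &
         forall i, V k i @[k --> \oo] --> psi i]).
Proof.
have hirr : forall v, stationary M v -> irreducible M v by have [] := hL.
have [W [n0 [r [C lyap]]]] := exists_risk_lyapunov hA hL.
have [l l0 cl] := lam_cvg lyap hPI.
have [psi [K [hpsi psiK cV]]] := value_cvg hA hB hirr lyap hPI l0 cl.
have ls := lambda_star_hjb hA lyap l0 hpsi psiK.
have hjbE phi : hjb_solution M i0 phi <-> hjb M i0 l phi.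
  by rewrite /hjb_solution ls.
split; first split.
- exact: (lam_nonincreasing hPI).
- by rewrite ls; apply: cvg_EFin => //; exact: nearW.
exists psi; split => //; first exact/hjbE.
by move=> phi /hjbE; exact: (hjb_unique hirr lyap l0 hpsi psiK).
Qed.
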